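(* Let $k$ be an infinite perfect field, $B=k[y_1,\ldots,y_n]$ a finitely generated $k$-algebra of dimension $d$, and $s$ a positive integer. Let $A$ be the $k$-subalgebra of $B$ generated by $d+s$ general $k$-linear combinations of $y_1,\ldots,y_n$. Then $B$ is a finite $A$-module, and $\dim_A B/A<d$ if and only if $B$ has embedding dimension at most $s$ locally at every minimal prime of dimension $d$, i.e. $\operatorname{edim} B_\mathfrak{q}\le s$ for every prime $\mathfrak{q}$ of $B$ with $\dim B/\mathfrak{q}=d$.
   Context: ''General'' means the coefficients of the linear combinations lie in a suitable nonempty Zariski open subset of the corresponding affine space over $k$. For a Noetherian local ring $(S,\mathfrak{n})$, $\operatorname{edim} S=\mu(\mathfrak{n})$ is the minimal number of generators of $\mathfrak{n}$. $\dim_A B/A$ is the Krull dimension of the $A$-module $B/A$. *)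

(* Defs.v *)
From HB Require Import structures.
From mathcomp Require Import all_boot all_order all_algebra.
From mathcomp Require Import mpoly.
Set Implicit Arguments. Unset Strict Implicit. Unset Printing Implicit Defensive.
Import Order.TTheory GRing.Theory.
Local Open Scope ring_scope.

Definition infinite_field (k : fieldType) : Prop :=
  forall s : seq k, exists x : k, x \notin s.

Definition perfect_field (k : fieldType) : Prop :=
  forall p : nat, p \in [pchar k] -> forall x : k, exists y : k, y ^+ p = x.

Section Alg.
Variables (k : fieldType) (B : comAlgType k).

Inductive subalg_gen (m : nat) (z : 'I_m -> B) : B -> Prop :=
  | sg_gen i : subalg_gen z (z i)
  | sg_scal (a : k) : subalg_gen z (a%:A)
  | sg_add x y : subalg_gen z x -> subalg_gen z y -> subalg_gen z (x + y)
  | sg_mul x y : subalg_gen z x -> subalg_gen z y -> subalg_gen z (x * y).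

Definition generates (n : nat) (y : 'I_n -> B) : Prop :=
  forall b : B, subalg_gen y b.

Definition finite_over (S : B -> Prop) : Prop :=
  exists bs : seq B, forall b : B, exists a : nat -> B,
    (forall i, S (a i)) /\ b = \sum_(i < size bs) a i * bs`_i.

Definition prime_in (S P : B -> Prop) : Prop :=
  (forall x, P x -> S x) /\
  P 0 /\
  (forall x y, P x -> P y -> P (x + y)) /\
  (forall a x, S a -> P x -> P (a * x)) /\
  ~ P 1 /\
  (forall x y, S x -> S y -> P (x * y) -> P x \/ P y).

Definition strict_sub (P Q : B -> Prop) : Prop :=
  (forall x, P x -> Q x) /\ exists x, Q x /\ ~ P x.

Definition dim_ge (S I : B -> Prop) (l : nat) : Prop :=
  exists P : nat -> (B -> Prop),
    (forall i, (i <= l)%N -> prime_in S (P i) /\ (forall x, I x -> P i x)) /\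
    (forall i, (i < l)%N -> strict_sub (P i) (P i.+1)).

Definition dim_eq (S I : B -> Prop) (d : nat) : Prop :=
  dim_ge S I d /\ ~ dim_ge S I d.+1.

Definition ann_quot (A : B -> Prop) : B -> Prop :=
  fun a => A a /\ forall b : B, A (a * b).

(* dim_A (B/A) < d  (Krull dimension of the A-module B/A, i.e. of A/Ann_A(B/A);
   the zero module has dimension -infinity) *)
Definition quot_dim_lt (A : B -> Prop) (d : nat) : Prop :=
  ~ dim_ge A (ann_quot A) d.

(* edim B_q <= s: the maximal ideal qB_q is generated by at most s elements;
   equivalently there are b_1..b_s in q such that for every x in q some u not
   in q has u*x in the ideal (b_1,..,b_s)B. *)
Definition edim_loc_le (q : B -> Prop) (s : nat) : Prop :=
  exists bs : seq B, (size bs <= s)%N /\ (forall b, b \in bs -> q b) /\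
    forall x, q x -> exists u : B, ~ q u /\
      exists r : nat -> B, u * x = \sum_(i < size bs) r i * bs`_i.

End Alg.

(* Main.v *)
(* Noether normalization by linear forms is an open condition, which gives finiteness.

   If dim_A B/A < d and q is a prime of dimension d, some a in A outside q satisfies
   aB <= A, so it suffices to generate q /\ A locally by s elements.  The first d forms
   z_1,..,z_d are independent modulo q, and each of the s remaining ones contributes a
   single relation of least degree.

   For the converse the coefficients c are taken as indeterminates and specialized
   afterwards, which makes the open condition explicit.  There are finitely many primes Q
   of dimension d.  The d+1 forms z_0,..,z_d satisfy a relation over k[c]; a relation
   H(c,z) in Q[c] of least degree has some dH/dz_i outside Q[c], since otherwise
   differentiating by the c_ij shows that all partial derivatives of H vanish, and H is a
   p-th power because k is perfect.  Differentiating H(c,z) by c_ij gives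
     omega_j := d/dc_ij H(c,z) = (dH/dz_i) y_j + dH/dc_ij  in Q[c],
   so that y_j lies in the localization of A modulo omega_1,..,omega_n.  Hence A separates
   Q from the other primes and Q is generated locally by elements of A and the omega_j.
   The element H(c,z) and the s-1 combinations sum_j c_lj omega_j, one for each of the
   remaining rows l, lie in A.  If they do not generate Q modulo Q^2, they are dependent
   there, as edim B_Q <= s; differentiating a dependence relation by the row of c on which
   only one of them depends yields the omega_j.  In either case A /\ Q generates Q
   locally, and A = B at Q by Nakayama. *)
Require Import Defs.
From HB Require Import structures.
From mathcomp Require Import all_boot all_order all_algebra.
From mathcomp Require Import mpoly.
From mathcomp Require Import ring.
From mathcomp Require boolp classical_sets.
From Stdlib Require Import Classical.
Import GRing.Theory.
Local Open Scope ring_scope.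

Set Implicit Arguments.
Unset Strict Implicit.
Unset Printing Implicit Defensive.

(** * Ideals and integrality as predicates *)

(** The open set must come from one nonzero polynomial in the coefficients, so each condition is
    either a determinant that is nonzero at one point, or an element of B[c] outside Q[c], whose
    specialization stays outside Q off a hypersurface. Finitely many conditions suffice, since a
    prime q with dim B/q = dim B is minimal. Normality is stated with a fixed degree bound N: it
    then becomes linear algebra between two finite-dimensional pieces of the degree filtration, and
    one N serves the whole open set. Derivatives by c are B-linear, so they preserve Q[c] and its
    square. Dependence modulo the square is therefore the relation that survives differentiation,
    and Nakayama removes the square after specialization. The relation H involves only d+1 of the
    d+s rows. The omega_j are thus constant in the s-1 other rows, and sum_j c_lj omega_j is linear
    in its own row l. This sum lies in A because omega_j = G_j + D0 y_j with G_j, D0 in A, so that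
    it equals D0 z_l plus an element of A. *)

Section Predicates.
Variable R : comNzRingType.
Implicit Types (S I P : R -> Prop).

Definition subring_pred S :=
  [/\ S 1, S (-1), forall x y, S x -> S y -> S (x + y)
    & forall x y, S x -> S y -> S (x * y)].

Definition ideal_pred I :=
  [/\ I 0, forall x y, I x -> I y -> I (x + y) & forall a x, I x -> I (a * x)].

Lemma subring0 S : subring_pred S -> S 0.
Proof. by move=> [S1 SN1 SD SM]; rewrite -(subrr 1); apply: SD. Qed.

Lemma subringN S x : subring_pred S -> S x -> S (- x).
Proof. by move=> [S1 SN1 SD SM] Sx; rewrite -mulN1r; apply: SM. Qed.

Lemma subring_sum S (T : Type) (r : seq T) (p : pred T) F : subring_pred S ->
  (forall i, p i -> S (F i)) -> S (\sum_(i <- r | p i) F i).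
Proof.
move=> hS hF; have S0 := subring0 hS; case: hS => S1 _ SD SM.
by apply: big_ind => //; exact: SD.
Qed.

Lemma subring_prod S (T : Type) (r : seq T) (p : pred T) F : subring_pred S ->
  (forall i, p i -> S (F i)) -> S (\prod_(i <- r | p i) F i).
Proof. by move=> [S1 _ SD SM] hF; apply: big_ind => //; exact: SM. Qed.

Lemma subringX S x m : subring_pred S -> S x -> S (x ^+ m).
Proof.
by move=> hS Sx; rewrite -[m]card_ord -prodr_const; apply: subring_prod.
Qed.

Lemma subring_det S m (A : 'M[R]_m) : subring_pred S ->
  (forall i j, S (A i j)) -> S (\det A).
Proof.
move=> hS hA; apply: subring_sum => // s _.
case: (hS) => S1 SN1 _ SM; apply: SM; last by apply: subring_prod.
by apply: subringX.
Qed.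

Lemma idealN I x : ideal_pred I -> I x -> I (- x).
Proof. by move=> [_ _ IM] Ix; rewrite -mulN1r; apply: IM. Qed.

Lemma idealB I x y : ideal_pred I -> I x -> I y -> I (x - y).
Proof. by move=> hI Ix Iy; case: (hI) => _ ID _; apply: ID => //; apply: idealN. Qed.

Lemma idealBC I x y : ideal_pred I -> I (x - y) -> I (y - x).
Proof. by move=> hI; rewrite -[y - x]opprB; apply: idealN. Qed.

Lemma ideal_mulr I a x : ideal_pred I -> I x -> I (x * a).
Proof. by move=> [_ _ IM] Ix; rewrite mulrC; apply: IM. Qed.

Lemma ideal_sum I (T : Type) (r : seq T) (p : pred T) F : ideal_pred I ->
  (forall i, p i -> I (F i)) -> I (\sum_(i <- r | p i) F i).
Proof. by move=> [I0 ID _] hF; apply: big_ind => //; exact: ID. Qed.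

Lemma ideal_trans I x y z : ideal_pred I -> I (x - y) -> I (y - z) -> I (x - z).
Proof.
move=> [_ ID _] h1 h2; rewrite (_ : x - z = (x - y) + (y - z)); last by ring.
exact: ID.
Qed.

Lemma ideal_congr_mem I x y : ideal_pred I -> I (x - y) -> I y -> I x.
Proof. by move=> [_ ID _] h Iy; rewrite -(subrK y x); apply: ID. Qed.

Lemma ideal_congrM I x y z t : ideal_pred I ->
  I (x - y) -> I (z - t) -> I (x * z - y * t).
Proof.
move=> [_ ID IM] h1 h2.
rewrite (_ : x * z - y * t = z * (x - y) + y * (z - t)); last by ring.
by apply: ID; apply: IM.
Qed.

Lemma ideal_congrD I x y z t : ideal_pred I ->
  I (x - y) -> I (z - t) -> I (x + z - (y + t)).
Proof. by move=> [_ ID _] h1 h2; rewrite opprD addrACA; apply: ID. Qed.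

Lemma ideal_congr_sum I (T : Type) (r : seq T) (p : pred T) F G : ideal_pred I ->
  (forall i, p i -> I (F i - G i)) ->
  I (\sum_(i <- r | p i) F i - \sum_(i <- r | p i) G i).
Proof. by move=> hI h; rewrite -sumrB; apply: ideal_sum. Qed.

Lemma ideal_congr_det I m (A C : 'M[R]_m) : ideal_pred I ->
  (forall i j, I (A i j - C i j)) -> I (\det A - \det C).
Proof.
move=> hI h; apply: ideal_congr_sum => // s _; rewrite -mulrBr.
case: (hI) => I0 ID IM; apply: IM.
elim/big_ind2: _; first by rewrite subrr.
- by move=> x1 x2 y1 y2; apply: ideal_congrM.
- by move=> i _; apply: h.
Qed.

Lemma det_mul_ideal I m (A : 'M[R]_m) (u : 'I_m -> R) : ideal_pred I ->
  (forall i, I (\sum_j A i j * u j)) -> forall i, I (\det A * u i).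
Proof.
move=> hI h i.
have -> : \det A * u i = \sum_j \adj A i j * \sum_l A j l * u l.
  transitivity (((\adj A *m A) *m (\col_l u l)) i 0).
    by rewrite mul_adj_mx mul_scalar_mx !mxE.
  by rewrite -mulmxA mxE; apply: eq_bigr => j _; rewrite !mxE; congr (_ * _);
     apply: eq_bigr => l _; rewrite !mxE.
by apply: ideal_sum => // j _; case: hI => _ _; apply.
Qed.

End Predicates.

Section Integrality.
Variable R : comNzRingType.
Implicit Types (S I : R -> Prop).

Definition integral_mod S I (b : R) := exists m (a : nat -> R),
  (forall i, S (a i)) /\ I (b ^+ m + \sum_(i < m) a i * b ^+ i).

(** Determinant trick: multiplication by b on the u_i is a matrix over S modulo I, and its
    characteristic polynomial is the integral equation. *)
Lemma integral_of_span S I m (u : 'I_m -> R) : subring_pred S -> ideal_pred I ->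
  (forall b, exists a : 'I_m -> R,
     (forall i, S (a i)) /\ I (b - \sum_i a i * u i)) ->
  forall b, integral_mod S I b.
Proof.
move=> hS hI span b.
have /fin_all_exists [a ha] (i : 'I_m) : exists a : 'I_m -> R,
    (forall j, S (a j)) /\ I (b * u i - \sum_j a j * u j) by exact: span.
pose A := \matrix_(i, j) a i j.
have hdet i : I ((char_poly A).[b] * u i).
  have -> : (char_poly A).[b] = \det (b%:M - A).
    rewrite -horner_evalE -det_map_mx; congr (\det _); apply/matrixP=> r c.
    by rewrite !mxE rmorphB rmorphMn /= /horner_eval hornerX hornerC.
  apply: (det_mul_ideal hI) => j.
  have -> : \sum_l (b%:M - A) j l * u l = b * u j - \sum_l a j l * u l.
    rewrite (eq_bigr (fun l => b%:M j l * u l - a j l * u l)).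
      rewrite sumrB; congr (_ - _); rewrite (bigD1 j) //= big1 ?addr0 ?mxE ?eqxx //.
      by move=> l /negPf jl; rewrite mxE eq_sym jl mul0r.
    by move=> l _; rewrite !mxE mulrBl.
  by case: (ha j).
(* 1 is a combination of the u_i modulo I, so killing all the u_i means lying in I. *)
have h1 : I (char_poly A).[b].
  have [c [hc hI1]] := span 1.
  rewrite -[X in I X]mulr1 -[X in _ * X](subrK (\sum_i c i * u i) 1) mulrDr.
  case: (hI) => I0 ID IM; apply: ID; first exact: IM.
  rewrite mulr_sumr; apply: ideal_sum => // i _; rewrite mulrCA; exact: IM.
(* Polynomials with coefficients in S form a subring, so the determinant of a matrix over it stays
   there. *)
have coefS i : S (char_poly A)`_i.
  pose T (p : {poly R}) := forall i, S p`_i.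
  suff : T (char_poly A) by apply.
  have [S1 SN1 SD SM] := hS; have S0 := subring0 hS.
  have hT : subring_pred T.
    split.
    - by move=> l; rewrite coef1; case: (l == 0)%N.
    - by move=> l; rewrite coefN coef1; case: (l == 0)%N; rewrite //= oppr0.
    - by move=> p q hp hq l; rewrite coefD; apply: SD.
    - by move=> p q hp hq l; rewrite coefM; apply: subring_sum => // t _; apply: SM.
  apply: subring_det => // r c l; rewrite !mxE coefB coefMn coefX coefC.
  apply: SD; last by apply: subringN => //; case: ifP => // _; case: (ha r).
  by case: (l == 1)%N; case: (r == c); rewrite ?mulr1n ?mulr0n.
exists m, (fun i => (char_poly A)`_i); split=> //.
move: h1; rewrite horner_coef size_char_poly big_ord_recr /=.
have := char_poly_monic A; rewrite monicE lead_coefE size_char_poly /= => /eqP->.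
by rewrite mul1r addrC.
Qed.

Lemma integral_mod_sub S I J b : (forall x, I x -> J x) ->
  integral_mod S I b -> integral_mod S J b.
Proof. by move=> h [m [a [Sa Ia]]]; exists m, a; split=> //; apply: h. Qed.

End Integrality.

(** * Prime ideals and going up *)

Section Primes.
Variables (k : fieldType) (B : comAlgType k).
Implicit Types (S I P Q : B -> Prop).

Definition all_of : B -> Prop := fun _ => True.
Definition only_zero : B -> Prop := fun b => b = 0.
Definition prime Q := prime_in all_of Q.

Lemma prime_ideal Q : prime Q -> ideal_pred Q.
Proof. by case=> _ [Q0 [QD [QM _]]]; split=> // a x; apply: QM. Qed.

Lemma prime_proper Q : prime Q -> ~ Q 1.
Proof. by case=> _ [_ [_ [_ []]]]. Qed.

Lemma primeM Q x y : prime Q -> Q (x * y) -> Q x \/ Q y.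
Proof. by case=> _ [_ [_ [_ [_ QP]]]]; apply: QP. Qed.

Lemma primeMn Q x y : prime Q -> ~ Q x -> ~ Q y -> ~ Q (x * y).
Proof. by move=> hQ nx ny /(primeM hQ) []. Qed.

Lemma primeX Q x m : prime Q -> Q (x ^+ m) -> Q x.
Proof.
move=> hQ; elim: m => [|m IH]; first by rewrite expr0 => /(prime_proper hQ).
by rewrite exprS => /(primeM hQ) [] //; apply: IH.
Qed.

Lemma prime_prod Q (T : Type) (r : seq T) (p : pred T) F : prime Q ->
  (forall i, p i -> ~ Q (F i)) -> ~ Q (\prod_(i <- r | p i) F i).
Proof.
move=> hQ hF; apply: (@big_ind _ (fun x => ~ Q x)) => //.
  exact: prime_proper.
by move=> x y; apply: primeMn.
Qed.

Lemma ideal_only_zero : ideal_pred only_zero.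
Proof.
by split=> [|x y -> ->|a x ->]; rewrite /only_zero ?addr0 ?mulr0.
Qed.

Lemma prime_contract S Q : subring_pred S -> prime Q ->
  prime_in S (fun x => S x /\ Q x).
Proof.
move=> hS hQ; have [S1 SN1 SD SM] := hS; have [Q0 QD QM] := prime_ideal hQ.
split; first by move=> x [].
split; first by split=> //; apply: subring0.
split; first by move=> x y [Sx Qx] [Sy Qy]; split; auto.
split; first by move=> a x Sa [Sx Qx]; split; auto.
split; first by case=> _; apply: prime_proper.
by move=> x y Sx Sy [_ /(primeM hQ) [] ?]; [left|right].
Qed.

(** In an integral equation of b modulo Q, a constant term in Q allows division by b, which is
    outside Q. After finitely many divisions the constant term is outside Q, and it is a multiple of
    b modulo Q. *)
Lemma integral_meets S Q b : prime Q -> integral_mod S Q b -> ~ Q b ->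
  exists a c, [/\ S a, ~ Q a & Q (a - c * b)].
Proof.
move=> hQ [m [a [Sa Qa]]] nb; elim: m a Sa Qa => [|m IH] a Sa.
  by rewrite expr0 big_ord0 addr0 => /(prime_proper hQ).
rewrite big_ord_recl expr0 mulr1 exprS.
set r := \sum_(i < m) _ => h.
have hr : r = b * \sum_(i < m) a i.+1 * b ^+ i.
  by rewrite mulr_sumr; apply: eq_bigr => i _; rewrite mulrCA -exprS.
have [Qa0|nQa0] := classic (Q (a 0%N)).
  apply: (IH (fun i => a i.+1)) => //.
  have /(primeM hQ) [] // : Q (b * (b ^+ m + \sum_(i < m) a i.+1 * b ^+ i)).
  rewrite mulrDr -hr; apply: (ideal_congr_mem (prime_ideal hQ) _ h).
  rewrite (_ : _ - _ = - a 0%N); last by ring.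
  by apply: idealN => //; apply: prime_ideal.
exists (a 0%N), (- (b ^+ m + \sum_(i < m) a i.+1 * b ^+ i)); split=> //.
by rewrite mulNr opprK [_ * b]mulrC mulrDr -hr addrCA.
Qed.

Section Lifting.
Variable S : B -> Prop.
Hypothesis hS : subring_pred S.
Hypothesis intS : forall b, integral_mod S only_zero b.

Lemma integral_mod_prime I b : ideal_pred I -> integral_mod S I b.
Proof. by move=> [I0 _ _]; apply: integral_mod_sub (intS b) => x ->. Qed.

(** Incomparability: an element b of Q_{i+1} outside Q_i has a multiple congruent modulo Q_i to an
    element of S outside Q_i. *)
Lemma chain_contract l (Q : nat -> B -> Prop) :
  (forall i, (i <= l)%N -> prime (Q i)) ->
  (forall i, (i < l)%N -> strict_sub (Q i) (Q i.+1)) ->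
  forall i, (i < l)%N ->
    strict_sub (fun x => S x /\ Q i x) (fun x => S x /\ Q i.+1 x).
Proof.
move=> pQ sQ i il; have [sub [b [Qb nb]]] := sQ i il.
have pQi := pQ i (ltnW il); have pQi1 := pQ i.+1 il.
split; first by move=> x [Sx /sub].
have [a [c [Sa na Qac]]] :=
  integral_meets pQi (integral_mod_prime b (prime_ideal pQi)) nb.
exists a; split; last by case.
split=> //; have [_ _ IM] := prime_ideal pQi1.
by apply: (ideal_congr_mem (prime_ideal pQi1) (sub _ Qac)); apply: IM.
Qed.

(* A maximal ideal among those containing [I] and contracting into [P] is prime
   and contracts exactly to [P]. *)
Lemma going_up P I : prime_in S P -> ideal_pred I ->
  (forall x, S x -> I x -> P x) ->
  exists J, [/\ prime J, forall x, I x -> J x & forall x, S x -> (J x <-> P x)].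
Proof.
move=> [PS [P0 [PD [PM [P1 PP]]]]] hI hIP; have [S1 SN1 SD SM] := hS.
pose good J := [/\ ideal_pred J, forall x, I x -> J x & forall x, S x -> J x -> P x].
pose T := {J : B -> Prop | good J}.
have gI : good I by [].
pose R (s t : T) := boolp.asbool (forall x, sval s x -> sval t x).
have RP (s t : T) : R s t <-> (forall x, sval s x -> sval t x).
  by split=> [/boolp.asboolP|?] //; apply/boolp.asboolP.
have [||A hA|[J gJ] maxJ] := @classical_sets.ZL_preorder T (exist _ I gI) R.
- by move=> t; apply/RP.
- by move=> r s t /RP h1 /RP h2; apply/RP => x /h1 /h2.
- have [[t0 At0]|nA] := classic (exists t, A t); last first.
    by exists (exist _ I gI) => s As; case: nA; exists s.
  pose U x := exists t, A t /\ sval t x.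
  have gU : good U.
    split; first split.
    + by exists t0; split=> //; case: t0 {At0} => J [[]].
    + move=> x y [s [As sx]] [t [At ty]].
      have [/RP st|/RP ts] := hA s t As At.
        by exists t; split=> //; case: (svalP t) => -[_ D _] _ _; apply: D => //; apply: st.
      by exists s; split=> //; case: (svalP s) => -[_ D _] _ _; apply: D => //; apply: ts.
    + by move=> a x [s [As sx]]; exists s; split=> //; case: (svalP s) => -[_ _ M] _ _; apply: M.
    + by move=> x Ix; exists t0; split=> //; case: (svalP t0) => _ + _; apply.
    + by move=> x Sx [t [At tx]]; case: (svalP t) => _ _; apply.
  by exists (exist _ U gU) => s As; apply/RP => x sx; exists s.
have [hJ IJ JP] := gJ; have [J0 JD JM] := hJ.
(* J + Bx is strictly larger than J, so by maximality its contraction leaves P. *)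
have escape x : ~ J x -> exists a c, [/\ S a, ~ P a & J (a - c * x)].
  move=> nx; apply: NNPP => hn; apply: nx.
  pose J' z := exists j c, J j /\ z = j + c * x.
  have gJ' : good J'.
    split; first split.
    + by exists 0, 0; rewrite mul0r addr0.
    + move=> _ _ [j [c [Jj ->]]] [j' [c' [Jj' ->]]]; exists (j + j'), (c + c').
      by split; [apply: JD|ring].
    + move=> a _ [j [c [Jj ->]]]; exists (a * j), (a * c).
      by split; [apply: JM|ring].
    + by move=> z /IJ Jz; exists z, 0; rewrite mul0r addr0.
    + move=> z Sz [j [c [Jj ez]]]; apply: NNPP => nPz; apply: hn.
      by exists z, c; split=> //; rewrite ez addrK.
  have JJ' : R (exist _ J gJ) (exist _ J' gJ').
    by apply/RP => z Jz; exists z, 0; rewrite mul0r addr0.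
  have /RP h := maxJ _ JJ'; apply: (h x).
  by exists 0, 1; rewrite mul1r add0r.
have JPiff x : S x -> (J x <-> P x).
  move=> Sx; split; first exact: JP.
  move=> Px; apply: NNPP => /escape [a [c [Sa nPa Jac]]].
  have [m [e [Se e0]]] := intS c.
  (* x^m times the integral equation of c becomes, after replacing c x by a modulo J, an element of
     J and S. As x lies in P, all its terms but a^m are in P, which forces a into P. *)
  have : P (a ^+ m + \sum_(i < m) e i * x ^+ (m - i) * a ^+ i).
    apply: JP.
      apply: (SD); first exact: subringX.
      apply: subring_sum => // i _; apply: (SM); last exact: subringX.
      by apply: (SM) => //; apply: subringX.
    have cong i : J (a ^+ i - (c * x) ^+ i).
      elim: i => [|i IH]; first by rewrite !expr0 subrr.
      by rewrite !exprS; apply: ideal_congrM.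
    pose z := x ^+ m * (c ^+ m + \sum_(i < m) e i * c ^+ i).
    apply: (@ideal_congr_mem _ J _ z) => //; rewrite /z; last first.
      by rewrite e0 mulr0.
    rewrite mulrDr -exprMn [x * c]mulrC; apply: ideal_congrD => //.
    rewrite mulr_sumr; apply: ideal_congr_sum => // i _.
    have -> : x ^+ m = x ^+ (m - i) * x ^+ i by rewrite -exprD subnK // ltnW.
    rewrite (_ : _ * _ * (_ * _) = e i * x ^+ (m - i) * (c * x) ^+ i); last first.
      by rewrite exprMn; ring.
    by apply: ideal_congrM => //; rewrite subrr.
  have Pam : P (a ^+ m + \sum_(i < m) e i * x ^+ (m - i) * a ^+ i) -> P (a ^+ m).
    move=> h; rewrite -[X in P X](addrK (\sum_(i < m) e i * x ^+ (m - i) * a ^+ i)).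
    apply: (PD) => //; rewrite -mulN1r; apply: (PM) => //.
    apply: (big_ind P) => [//|x1 y1|i _]; [exact: PD|rewrite mulrAC mulrC].
    have mi : (0 < m - i)%N by rewrite subn_gt0.
    rewrite -(prednK mi) exprSr -mulrA; apply: (PM).
      exact: subringX.
    by rewrite mulrC; apply: (PM) => //; apply: (SM) => //; apply: subringX.
  move/Pam; elim: m {e Se e0 Pam} => [|m IH]; first by rewrite expr0.
  by rewrite exprS => /PP [] //; apply: subringX.
exists J; split=> //; split=> //; split=> //; split=> //; split.
  by move=> a x _; apply: JM.
split; first by move=> J1; apply: P1; apply: JP.
move=> x y _ _ Jxy; apply: NNPP => /not_or_and [nx ny].
have [a [c [Sa nPa Jac]]] := escape _ nx.
have [a' [c' [Sa' nPa' Jac']]] := escape _ ny.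
have : P (a * a').
  apply: JP; first exact: SM.
  apply: (ideal_congr_mem hJ (ideal_congrM hJ Jac Jac')).
  by rewrite mulrACA; apply: JM.
by case/PP.
Qed.

Lemma chain_lift l (P : nat -> B -> Prop) I :
  (forall i, (i <= l)%N -> prime_in S (P i)) ->
  (forall i, (i < l)%N -> strict_sub (P i) (P i.+1)) ->
  ideal_pred I -> (forall x, S x -> I x -> P 0%N x) ->
  exists Q : nat -> B -> Prop,
   [/\ forall i, (i <= l)%N -> prime (Q i) /\ (forall x, I x -> Q i x),
       forall i, (i < l)%N -> strict_sub (Q i) (Q i.+1)
     & forall i, (i <= l)%N -> forall x, S x -> (Q i x <-> P i x)].
Proof.
elim: l P I => [|l IH] P I pP sP hI IP.
  have [J [pJ IJ JP]] := going_up (pP 0%N isT) hI IP.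
  by exists (fun _ => J); split=> // i; rewrite leqn0 => /eqP->.
have [J [pJ IJ JP]] := going_up (pP 0%N isT) hI IP.
have [||||Q [pQ sQ QP]] := IH (fun i => P i.+1) J.
- by move=> i il; apply: pP.
- by move=> i il; apply: sP.
- exact: prime_ideal.
- by move=> x Sx /(JP _ Sx); case: (sP 0%N isT) => sub _; apply: sub.
exists (fun i => if i is i'.+1 then Q i' else J); split.
- case=> [|i] il //; split; first by case: (pQ i il).
  by move=> x /IJ; case: (pQ i il) => _; apply.
- case=> [|i] il; last exact: sQ.
  have [_ JQ] := pQ 0%N isT; split=> //.
  have [_ [x [P1x nP0x]]] := sP 0%N isT.
  have Sx : S x by case: (pP 1%N isT) => + _; apply.
  by exists x; split; [apply/QP|move/(JP _ Sx)].
- by case=> [|i] il x Sx; [apply: JP|apply: QP].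
Qed.

End Lifting.

Lemma dim_ge_prime_chain Q l : prime Q -> dim_ge all_of Q l ->
  exists P : nat -> B -> Prop,
   [/\ forall i, (i <= l)%N -> prime (P i),
       forall i, (i < l)%N -> strict_sub (P i) (P i.+1) & P 0%N = Q].
Proof.
move=> pQ [P [pP sP]].
(* The lowest term of a chain above Q may be replaced by Q itself, which fixes where the chain
   starts. *)
exists (fun i => if i is _.+1 then P i else Q); split=> //.
  by case=> [|i] il //; case: (pP _ il).
case=> [|i] il; last exact: sP.
have [sub [x [P1x nx]]] := sP 0%N il; have [_ QP] := pP 0%N isT.
by split=> [z /QP /sub //|]; exists x; split=> // /QP.
Qed.

Lemma chain_sub (P : nat -> B -> Prop) l :
  (forall i, (i < l)%N -> strict_sub (P i) (P i.+1)) ->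
  forall i, (i <= l)%N -> forall x, P 0%N x -> P i x.
Proof.
move=> sP; elim=> [|i IH] il x P0 //.
by case: (sP i il) => sub _; apply: sub; apply: IH => //; apply: ltnW.
Qed.

(** Padding by zeros gives exactly s elements; s elements of Q expressed in them then have a square
    coefficient matrix. *)
Lemma edim_loc_family Q s : prime Q -> edim_loc_le Q s ->
  exists b : 'I_s -> B, (forall t, Q (b t)) /\
    forall x, Q x -> exists u, ~ Q u /\
      exists r : 'I_s -> B, u * x = \sum_t r t * b t.
Proof.
move=> pQ [bs [sbs [Qbs genbs]]]; exists (fun t => bs`_t); split=> [t|x /genbs].
  have [h|h] := ltnP t (size bs); first by apply: Qbs; rewrite mem_nth.
  by rewrite nth_default //; case: (prime_ideal pQ).
move=> [u [nu [r hr]]]; exists u; split=> //; exists (fun t => r t).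
rewrite hr (big_ord_widen s (fun j => r j * bs`_j)) // big_mkcond.
by apply: eq_bigr => t _; case: ltnP => // h; rewrite nth_default ?mulr0.
Qed.

End Primes.
Arguments all_of {k B}.
Arguments only_zero {k B}.

(** * Polynomials over an infinite field *)

Section PolynomialMaps.

Lemma mpoly_ext m (R S : comNzRingType) (g1 g2 : {rmorphism {mpoly R[m]} -> S}) :
  (forall c, g1 c%:MP = g2 c%:MP) -> (forall i, g1 'X_i = g2 'X_i) -> g1 =1 g2.
Proof.
move=> hC hX; elim/mpolyind; first by rewrite !rmorph0.
move=> c m' p _ _ IH; rewrite !rmorphD IH -mul_mpolyC !rmorphM /= hC.
congr (_ * _ + _); rewrite mpolyXE_id !rmorph_prod; apply: eq_bigr => i _.
by rewrite !rmorphXn hX.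
Qed.

Lemma mmap_XU m (R S : comNzRingType) (f : R -> S) (h : 'I_m -> S) i :
  f 1 = 1 -> mmap f h 'X_i = h i.
Proof.
by move=> f1; rewrite /mmap msuppX big_seq1 mcoeffX eqxx f1 mul1r mmap1U.
Qed.

Lemma rmorph_mmap m (R S T : comNzRingType) (g : {rmorphism S -> T})
    (f : {rmorphism R -> S}) (h : 'I_m -> S) p :
  g (mmap f h p) = mmap (g \o f) (g \o h) p.
Proof.
apply: (@mpoly_ext _ _ _ (g \o mmap f h) (mmap (g \o f) (g \o h))) => [c|i] /=.
  by rewrite !mmapC.
by rewrite !mmap_XU //= ?rmorph1.
Qed.

Lemma eq_mmap m (R S : comNzRingType) (f1 f2 : R -> S) (h1 h2 : 'I_m -> S) p :
  f1 =1 f2 -> h1 =1 h2 -> mmap f1 h1 p = mmap f2 h2 p.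
Proof.
move=> ef eh; rewrite /mmap; apply: eq_bigr => u _; rewrite ef; congr (_ * _).
by apply: eq_bigr => i _; rewrite eh.
Qed.

Lemma infinite_uniq (k : fieldType) N : infinite_field k ->
  exists s : seq k, uniq s /\ size s = N.
Proof.
move=> kinf; elim: N => [|N [s [us ss]]]; first by exists [::].
by have [x xs] := kinf s; exists (x :: s); rewrite /= xs us ss.
Qed.

Lemma poly_nonvanishing (k : fieldType) (p : {poly k}) : infinite_field k ->
  p != 0 -> exists t, p.[t] != 0.
Proof.
move=> kinf p0; have [s [us ss]] := infinite_uniq (size p) kinf.
apply: NNPP => hn; have := max_poly_roots p0 (rs := s); rewrite ss ltnn => h.
suff : false by []. apply: h => //; apply/allP => x _.
by apply/rootP/eqP; apply: contra_notT hn => hx; exists x.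
Qed.

Lemma mpoly0_const (R : nzRingType) (F : {mpoly R[0]}) : F = (F@_0)%:MP.
Proof.
apply/msize1_polyC; rewrite msizeE; apply/bigmax_leqP_seq => u _ _.
by rewrite ltnS mdegE big_ord0.
Qed.

(** The last variable becomes the main variable, for an induction on the number of variables. *)
Definition as_poly m (k : fieldType) (i : 'I_m.+1) : {poly {mpoly k[m]}} :=
  if unlift ord_max i is Some j then ('X_j)%:P else 'X.

Lemma mpoly_nonvanishing m (k : fieldType) (F : {mpoly k[m]}) : infinite_field k ->
  F != 0 -> exists v : 'I_m -> k, F.@[v] != 0.
Proof.
move=> kinf; elim: m F => [|m IH] F F0.
  exists (fun _ => 0); rewrite (mpoly0_const F) mevalC.
  by apply: contraNneq F0 => F0; rewrite (mpoly0_const F) F0.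
pose P := mmap (polyC \o @mpolyC m k) (@as_poly m k) F.
pose back := (horner_eval ('X_ord_max : {mpoly k[m.+1]}) \o
  map_poly (mmap (@mpolyC m.+1 k) (fun j => 'X_(lift ord_max j)))).
have backP : back P = F.
  apply: (@mpoly_ext _ _ _ (back \o mmap (polyC \o @mpolyC m k) (@as_poly m k)) idfun).
    by move=> c /=; rewrite mmapC /= map_polyC /= mmapC /horner_eval hornerC.
  move=> i /=; rewrite mmap_XU ?rmorph1 // /as_poly; case: unliftP => [j|] ->.
    by rewrite map_polyC /= mmap_XU ?rmorph1 // /horner_eval hornerC.
  by rewrite map_polyX /horner_eval hornerX.
have P0 : P != 0.
  apply: contraNneq F0 => P0.
  by rewrite -backP P0 /back /= /horner_eval rmorph0 horner0.
have [v hv] : exists v : 'I_m -> k, (lead_coef P).@[v] != 0.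
  by apply: IH; rewrite lead_coef_eq0.
have [t ht] : exists t, (map_poly (meval v) P).[t] != 0.
  apply: poly_nonvanishing => //; apply: contraNneq hv => /polyP /(_ (size P).-1).
  by rewrite coef_map /= coef0 => ->.
exists (fun i => if unlift ord_max i is Some j then v j else t).
suff <- : (map_poly (meval v) P).[t] =
  F.@[fun i => if unlift ord_max i is Some j then v j else t] by [].
apply: (@mpoly_ext _ _ _ (horner_eval t \o map_poly (meval v) \o
    mmap (polyC \o @mpolyC m k) (@as_poly m k))
    (meval (fun i => if unlift ord_max i is Some j then v j else t))).
  by move=> c /=; rewrite mmapC /= map_polyC /= !mevalC /horner_eval hornerC.
move=> i /=; rewrite mmap_XU ?rmorph1 // mevalXU /as_poly; case: unliftP => [j|] _.
  by rewrite map_polyC /= mevalXU /horner_eval hornerC.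
by rewrite map_polyX /horner_eval hornerX.
Qed.

End PolynomialMaps.

(** * Noether normalization by linear forms *)

Section LinearNormalization.
Variables (k : fieldType) (n : nat) (B : comAlgType k) (y : 'I_n -> B).
Implicit Types (I Q : B -> Prop).

(** Degree filtration: the image in B of the polynomials of degree at most N in the y_j. *)
Inductive fil : nat -> B -> Prop :=
  | fil1 : fil 0 1
  | filS N b : fil N b -> fil N.+1 b
  | filY N j b : fil N b -> fil N.+1 (y j * b)
  | filD N a b : fil N a -> fil N b -> fil N (a + b)
  | filZ N (c : k) b : fil N b -> fil N (c *: b).

Definition lin (x : B) := exists c : 'I_n -> k, x = \sum_j c j *: y j.

Lemma fil_le N M b : (N <= M)%N -> fil N b -> fil M b.
Proof. by move/subnKC <-; elim: (M - N)%N => [|r IH] h; rewrite ?addn0 // addnS; apply/filS/IH. Qed.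

Lemma fil0 N : fil N 0.
Proof. by rewrite -(scale0r 1); apply: filZ; apply: fil_le fil1. Qed.

Lemma fil_sum N (T : Type) (r : seq T) (p : pred T) F :
  (forall i, p i -> fil N (F i)) -> fil N (\sum_(i <- r | p i) F i).
Proof. by move=> h; apply: big_ind => //; [exact: fil0|exact: filD]. Qed.

Lemma filM N M a b : fil N a -> fil M b -> fil (N + M) (a * b).
Proof.
elim=> {N a} [|N a _ IH|N j a _ IH|N a a' _ IH _ IH'|N c a _ IH] hb.
- by rewrite mul1r.
- by rewrite addSn; apply/filS/IH.
- by rewrite addSn -mulrA; apply/filY/IH.
- by rewrite mulrDl; apply: filD; [apply: IH|apply: IH'].
- by rewrite -scalerAl; apply/filZ/IH.
Qed.

Lemma filX N a r : fil N a -> fil (r * N) (a ^+ r).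
Proof.
move=> h; elim: r => [|r IH]; first by rewrite expr0; exact: fil1.
by rewrite exprS mulSn; apply: filM.
Qed.

Lemma fil_gen j : fil 1 (y j).
Proof. by rewrite -[y j]mulr1; apply/filY/fil1. Qed.

Lemma lin_fil x : lin x -> fil 1 x.
Proof. by move=> [c ->]; apply: fil_sum => j _; apply/filZ/fil_gen. Qed.

Lemma linB x z : lin x -> lin z -> lin (x - z).
Proof.
move=> [c ->] [e ->]; exists (fun j => c j - e j).
by rewrite -sumrB; apply: eq_bigr => j _; rewrite scalerBl.
Qed.

Lemma linZ (a : k) x : lin x -> lin (a *: x).
Proof.
move=> [c ->]; exists (fun j => a * c j).
by rewrite scaler_sumr; apply: eq_bigr => j _; rewrite scalerA.
Qed.

Lemma lin_y j : lin (y j).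
Proof.
exists (fun i => (i == j)%:R); rewrite (bigD1 j) //= eqxx scale1r big1 ?addr0 //.
by move=> i /negPf ->; rewrite scale0r.
Qed.

Lemma fil_decomp N b : fil N.+1 b -> exists (c : 'I_n -> B) (e : B),
  [/\ forall j, fil N (c j), fil N e & b = \sum_j y j * c j + e].
Proof.
move eM: N.+1 => M h.
elim: h N eM => {M b} [|M b hb _|M j b hb _|M a b _ IHa _ IHb|M c b _ IH] N //.
- move=> [->]; exists (fun _ => 0), b; split=> //; first by move=> _; exact: fil0.
  by rewrite big1 ?add0r // => j _; rewrite mulr0.
- move=> [->]; exists (fun i => if i == j then b else 0), 0; split.
  + by move=> i; case: ifP => // _; exact: fil0.
  + exact: fil0.
  + rewrite addr0 (bigD1 j) //= eqxx big1 ?addr0 // => i /negPf ->; exact: mulr0.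
- move=> /[dup] /IHa [c [e [hc he ->]]] /IHb [c' [e' [hc' he' ->]]].
  exists (fun j => c j + c' j), (e + e'); split.
  + by move=> j; apply: filD.
  + exact: filD.
  + by rewrite addrACA -big_split; congr (_ + _); apply: eq_bigr => j _; rewrite mulrDr.
- move=> /IH [a [e [ha he ->]]].
  exists (fun j => c *: a j), (c *: e); split.
  + by move=> j; apply: filZ.
  + exact: filZ.
  + rewrite scalerDr scaler_sumr; congr (_ + _); apply: eq_bigr => j _.
    by rewrite scalerAr.
Qed.

Section Modulo.
Variable I : B -> Prop.
Hypothesis hI : ideal_pred I.

Definition red m (x : 'I_m -> B) N b := exists (c : 'I_m -> B) (e : B),
  [/\ forall j, fil N (c j), fil N e & I (b - (\sum_j x j * c j + e))].

(* The homogeneous form of "B/I is finite over k[x]": in degrees > N, every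
   element is a combination of the x_i up to lower order. *)
Definition normal m (x : 'I_m -> B) N := forall b, fil N.+1 b -> red x N b.

Section Red.
Variables (m : nat) (x : 'I_m -> B).

Lemma red_low N b : fil N b -> red x N b.
Proof.
exists (fun _ => 0), b; split=> //; first by move=> _; exact: fil0.
by rewrite big1 ?add0r ?subrr => [|j _]; [case: hI|rewrite mulr0].
Qed.

Lemma red_congr N a b : I (a - b) -> red x N b -> red x N a.
Proof.
move=> hab [c [e [hc he h]]]; exists c, e; split=> //.
exact: ideal_trans hab h.
Qed.

Lemma redD N a b : red x N a -> red x N b -> red x N (a + b).
Proof.
move=> [c [e [hc he h]]] [c' [e' [hc' he' h']]].
exists (fun j => c j + c' j), (e + e'); split.
- by move=> j; apply: filD.
- exact: filD.
- rewrite (_ : \sum_j _ + _ = \sum_j x j * c j + e + (\sum_j x j * c' j + e')).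
    exact: ideal_congrD.
  by rewrite addrACA -big_split; congr (_ + _); apply: eq_bigr => j _; rewrite mulrDr.
Qed.

Lemma redM N M a b : fil M a -> red x N b -> red x (M + N) (a * b).
Proof.
move=> ha [c [e [hc he h]]]; exists (fun j => a * c j), (a * e); split.
- by move=> j; apply: filM.
- exact: filM.
- rewrite (_ : \sum_j _ + _ = a * (\sum_j x j * c j + e)).
    by rewrite -mulrBr; case: hI => _ _; apply.
  by rewrite mulrDr mulr_sumr; congr (_ + _); apply: eq_bigr => j _; rewrite mulrCA.
Qed.

Lemma redZ N (c : k) b : red x N b -> red x N (c *: b).
Proof.
by move=> h; rewrite -[c *: b](mulr_algl) -[N]add0n; apply: redM => //; apply/filZ/fil1.
Qed.

Lemma red_sum N (T : Type) (r : seq T) (p : pred T) F :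
  (forall i, p i -> red x N (F i)) -> red x N (\sum_(i <- r | p i) F i).
Proof.
by move=> h; apply: big_ind => //; [apply/red_low/fil0|exact: redD].
Qed.

Lemma redN N b : red x N b -> red x N (- b).
Proof. by rewrite -scaleN1r; apply: redZ. Qed.

Lemma red_in N b : I b -> red x N b.
Proof. by move=> Ib; apply: (@red_congr _ _ 0); [rewrite subr0|apply/red_low/fil0]. Qed.

Lemma red_x N i b : fil N b -> red x N (x i * b).
Proof.
move=> hb; exists (fun j => if j == i then b else 0), 0; split.
- by move=> j; case: ifP => // _; exact: fil0.
- exact: fil0.
- rewrite addr0 (bigD1 i) //= eqxx big1 ?addr0 ?subrr; first by case: hI.
  by move=> j /negPf ->; rewrite mulr0.
Qed.

Lemma normalS N : normal x N -> normal x N.+1.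
Proof.
move=> h b /fil_decomp [c [e [hc he ->]]]; apply: redD; last exact: red_low.
apply: red_sum => j _; rewrite -[N.+1]add1n; apply: redM; first exact: fil_gen.
exact: h.
Qed.

Lemma normalD N r : normal x N -> normal x (N + r).
Proof. by elim: r => [|r IH] h; rewrite ?addn0 // addnS; apply/normalS/IH. Qed.

End Red.

Definition evalB m (x : 'I_m -> B) (F : {mpoly k[m]}) : B := mmap (in_alg B) x F.

Lemma evalBE m (x : 'I_m -> B) F :
  evalB x F = \sum_(u <- msupp F) F@_u *: mmap1 x u.
Proof. by apply: eq_bigr => u _; rewrite /= mulr_algl. Qed.

Lemma mnm_split m (u : 'X_{1..m}) r : mdeg u = r.+1 ->
  exists i v, u = (U_(i) + v)%MM /\ mdeg v = r.
Proof.
move=> du; have [i ui] : exists i, (0 < u i)%N.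
  apply: NNPP => hn; have : mdeg u = 0%N.
    rewrite mdegE big1 // => i _; apply/eqP; rewrite -leqn0 leqNgt.
    by apply/negP => ui; apply: hn; exists i.
  by rewrite du.
exists i, (u - U_(i))%MM.
have e : u = (U_(i) + (u - U_(i)))%MM.
  rewrite addmC submK //; apply/mnm_lepP => j; rewrite mnm1E.
  by case: eqP => // <-.
by split=> //; apply/eqP; rewrite -eqSS -du {2}e mdegD mdeg1.
Qed.

(* Writing x_l = x'_l + lambda_l t, a relation of degree r whose leading form does
   not vanish at lambda makes t^r reducible modulo the x'_l. *)
Section Eliminate.
Variables (m : nat) (x : 'I_m.+1 -> B) (lam : 'I_m.+1 -> k) (i0 : 'I_m.+1).
Hypothesis linx : forall i, lin (x i).
Hypothesis lam0 : lam i0 != 0.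

Let t := (lam i0)^-1 *: x i0.
Let x' (l : 'I_m) := x (lift i0 l) - lam (lift i0 l) *: t.

Lemma lin_eliminated l : lin (x' l).
Proof. by apply: linB => //; do 2![apply: linZ] => //. Qed.

Let fil_t : fil 1 t. Proof. by apply/lin_fil/linZ. Qed.

Lemma red_eliminated N l b : fil N b -> red x' N (x l * b - lam l *: (t * b)).
Proof.
move=> hb; have -> : x l * b - lam l *: (t * b) = (x l - lam l *: t) * b.
  by rewrite mulrBl scalerAl.
have [j ->|->] := unliftP i0 l; first exact: red_x.
by rewrite /t scalerA mulfV // scale1r subrr mul0r; apply/red_low/fil0.
Qed.

Lemma fil_mmap1 u : fil (mdeg u) (mmap1 x u).
Proof.
rewrite mdegE /mmap1; elim/big_rec2: _ => [|i N b _ h]; first exact: fil1.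
by apply: filM => //; rewrite -{1}[u i]muln1; apply/filX/lin_fil.
Qed.

(** The factors are replaced one at a time: each x_l is lambda_l t up to a multiple of some x'_l. *)
Lemma red_monomial r u : mdeg u = r.+1 ->
  red x' r (mmap1 x u - mmap1 lam u *: t ^+ r.+1).
Proof.
elim: r u => [|r IH] u /mnm_split [i [v [-> dv]]].
  have -> : v = 0%MM by apply/eqP; rewrite -mdeg_eq0 dv.
  rewrite addm0 !mmap1U expr1 -[x i]mulr1 -[t in X in red _ _ X]mulr1.
  exact/red_eliminated/fil1.
rewrite !(commr_mmap1_M, mmap1U); try by move=> *; apply: mulrC.
rewrite (_ : _ - _ = (x i * mmap1 x v - lam i *: (t * mmap1 x v)) +
    (lam i *: t) * (mmap1 x v - mmap1 lam v *: t ^+ r.+1)); last first.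
  move: (t) => T; rewrite mulrBr -!scalerAl -!scalerAr exprS [in RHS]scalerA.
  by rewrite addrA subrK.
apply: redD; first by apply: red_eliminated; rewrite -dv; apply: fil_mmap1.
by rewrite -[r.+1]add1n; apply: redM; [apply: filZ|apply: IH].
Qed.

(** The form of top degree r+1 contributes its value at lambda times t^(r+1); the lower monomials
    already have degree at most r. *)
Lemma red_power (F : {mpoly k[m.+1]}) r :
  msize F = r.+2 -> I (evalB x F) -> (pihomog mdeg r.+1 F).@[lam] != 0 ->
  red x' r (t ^+ r.+1).
Proof.
move=> sF IF nF; rewrite -[_ ^+ _]scale1r -(mulVf nF) -scalerA; apply: redZ.
rewrite -[X in red _ _ X](subrK (evalB x F)); apply: redD; last exact: red_in.
rewrite -opprB; apply: redN; rewrite /pihomog evalBE raddf_sum /= scaler_suml.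
rewrite [X in _ - X]big_mkcond -sumrB /= big_seq; apply: red_sum => u uF.
have := msize_mdeg_lt uF; rewrite sF ltnS leq_eqVlt => /orP [/eqP du|du].
  rewrite du eqxx mevalZ -scalerA -scalerBr; apply: redZ.
  by rewrite mevalX; apply: red_monomial.
rewrite ltn_eqF // subr0; apply: redZ; apply: red_low.
by apply: (fil_le _ (fil_mmap1 u)).
Qed.

(** Modulo the x' and lower degree, an element of degree M+1 is t times one of degree M. Doing this
    r+1 times from degree N+r+1 leaves t^(r+1) b0 with b0 of degree N, and t^(r+1) is reducible. *)
Lemma normal_eliminated N r : normal x N -> red x' r (t ^+ r.+1) ->
  normal x' (N + r).
Proof.
move=> hx ht.
have step M b : normal x M -> fil M.+1 b -> exists b0, fil M b0 /\ red x' M (b - t * b0).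
  move=> hM /hM [c [e [hc he h]]]; exists (\sum_l lam l *: c l); split.
    by apply: fil_sum => l _; apply: filZ.
  rewrite (_ : b - _ = (b - (\sum_j x j * c j + e)) +
     (\sum_j (x j * c j - lam j *: (t * c j)) + e)); last first.
    rewrite sumrB mulr_sumr (eq_bigr (fun l => lam l *: (t * c l))); last first.
      by move=> l _; rewrite scalerAr.
    by ring.
  apply: redD; first exact: red_in.
  by apply: redD; [apply: red_sum => l _; apply: red_eliminated|apply: red_low].
have steps q b : fil (N + q).+1 b ->
    exists b0, fil N b0 /\ red x' (N + q) (b - t ^+ q.+1 * b0).
  elim: q b => [|q IH] b.
    by rewrite addn0 expr1; apply: step.
  rewrite addnS => /(step _ _ (normalS (normalD hx))) [b1 [/IH [b0 [h0 h1]] h2]].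
  exists b0; split=> //; rewrite (_ : b - _ = (b - t * b1) + t * (b1 - t ^+ q.+1 * b0)).
    by apply: redD => //; rewrite -[(N + q).+1]add1n; apply: redM.
  by rewrite exprS; ring.
move=> b /steps [b0 [h0 h1]]; rewrite -(subrK (t ^+ r.+1 * b0) b).
by apply: redD => //; rewrite mulrC; apply: redM.
Qed.

End Eliminate.

Lemma normal_drop m (x : 'I_m.+1 -> B) N F : infinite_field k ->
  (forall i, lin (x i)) -> normal x N -> F != 0 -> I (evalB x F) ->
  exists (x' : 'I_m -> B) N', (forall i, lin (x' i)) /\ normal x' N'.
Proof.
move=> kinf linx hx F0 IF.
case sF: (msize F) => [|[|r]].
- by move: F0; rewrite -msize_poly_eq0 sF.
(* A nonzero constant in I makes I all of B, where any forms are normal. *)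
- have /msize_poly1P [c c0 eF] : msize F == 1%N by rewrite sF.
  have I1 b : I b.
    move: IF; rewrite eF /evalB mmapC /= => Ic; case: hI => _ _ IM.
    have := IM (c^-1 *: b) _ Ic; rewrite mulr_algr scalerA mulfV //.
    by rewrite scale1r.
  exists (fun _ => 0), 0%N; split=> [i|b _]; last exact: red_in.
  by exists (fun _ => 0); rewrite big1 // => j _; rewrite scale0r.
- have [lam hlam] : exists lam, (pihomog mdeg r.+1 F).@[lam] != 0.
    apply: mpoly_nonvanishing => //; apply: contraNneq (F0) => h.
    rewrite -mleadc_eq0; have := mlead_deg F0; rewrite sF => -[dF].
    have <- : (pihomog mdeg r.+1 F)@_(mlead F) = mleadc F.
      rewrite /pihomog raddf_sum /= big_mkcond (bigD1_seq (mlead F)) /= ?mlead_supp ?msupp_uniq //.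
      rewrite dF eqxx mcoeffZ mcoeffX eqxx mulr1 big1 ?addr0 //.
      by move=> u ul; case: ifP => // _; rewrite mcoeffZ mcoeffX (negPf ul) mulr0.
    by rewrite h mcoeff0.
  (* A form of positive degree vanishes at the origin, so lambda is not the origin. *)
  have [i0 l0] : exists i, lam i != 0.
    apply: NNPP => hn; case/negP: hlam.
    rewrite /pihomog raddf_sum /= big1 // => u /eqP du.
    have [i [v [-> _]]] := mnm_split du.
    have li : lam i = 0 by apply: NNPP => li; apply: hn; exists i; apply/eqP.
    by rewrite mevalZ mpolyXD mevalM mevalXU li mul0r mulr0.
  pose t := (lam i0)^-1 *: x i0.
  exists (fun l => x (lift i0 l) - lam (lift i0 l) *: t), (N + r)%N; split.
    exact: lin_eliminated.
  by apply: normal_eliminated => //; apply: red_power hlam.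
Qed.

End Modulo.
End LinearNormalization.

(** * Krull dimension through normal families of linear forms *)

Section DimensionTheory.
Variables (k : fieldType) (n : nat) (B : comAlgType k) (y : 'I_n -> B).
Implicit Types (I Q : B -> Prop).
Hypothesis kinf : infinite_field k.
Hypothesis geny : generates y.

Definition img m (x : 'I_m -> B) (b : B) := exists F, b = evalB x F.

Lemma evalBM m (x : 'I_m -> B) F G : evalB x (F * G) = evalB x F * evalB x G.
Proof. by rewrite /evalB rmorphM. Qed.
Lemma evalBD m (x : 'I_m -> B) F G : evalB x (F + G) = evalB x F + evalB x G.
Proof. by rewrite /evalB rmorphD. Qed.
Lemma evalBC m (x : 'I_m -> B) c : evalB x c%:MP = c%:A.
Proof. by rewrite /evalB mmapC. Qed.
Lemma evalBX m (x : 'I_m -> B) i : evalB x 'X_i = x i.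
Proof. by rewrite /evalB mmap_XU //= scale1r. Qed.

Lemma img_subring m (x : 'I_m -> B) : subring_pred (img x).
Proof.
split.
- by exists 1; rewrite /evalB rmorph1.
- by exists (-1); rewrite /evalB rmorphN1.
- by move=> _ _ [F ->] [G ->]; exists (F + G); rewrite evalBD.
- by move=> _ _ [F ->] [G ->]; exists (F * G); rewrite evalBM.
Qed.

Lemma subalg_gen_subring m (x : 'I_m -> B) : subring_pred (subalg_gen x).
Proof.
split; [rewrite -(scale1r 1)|rewrite -scaleN1r| |]; [exact: sg_scal|exact: sg_scal|..].
- by move=> a b; apply: sg_add.
- by move=> a b; apply: sg_mul.
Qed.

Lemma subalg_genE m (x : 'I_m -> B) b : subalg_gen x b <-> img x b.
Proof.
split.
  elim=> {b} [i|c|a b _ ha _ hb|a b _ ha _ hb].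
  - by exists 'X_i; rewrite evalBX.
  - by exists c%:MP; rewrite evalBC.
  - by case: (img_subring x) => _ _ + _; apply.
  - by case: (img_subring x) => _ _ _; apply.
have hS := subalg_gen_subring x; have [S1 _ SD SM] := hS.
move=> [F ->]; rewrite evalBE; apply: subring_sum => // u _.
rewrite -mulr_algl; apply: SM; first exact: sg_scal.
by apply: subring_prod => // i _; apply: subringX => //; apply: sg_gen.
Qed.

Lemma fil_span N : exists m (u : 'I_m -> B), (forall i, fil y N (u i)) /\
  forall b, fil y N b -> exists c : 'I_m -> k, b = \sum_i c i *: u i.
Proof.
pose good m (u : 'I_m -> B) b := exists c : 'I_m -> k, b = \sum_i c i *: u i.
have goodD m (u : 'I_m -> B) a b : good m u a -> good m u b -> good m u (a + b).
  move=> [c ->] [e ->]; exists (fun i => c i + e i).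
  by rewrite -big_split; apply: eq_bigr => i _; rewrite scalerDl.
have goodZ m (u : 'I_m -> B) c b : good m u b -> good m u (c *: b).
  move=> [e ->]; exists (fun i => c * e i).
  by rewrite scaler_sumr; apply: eq_bigr => i _; rewrite scalerA.
have goodG m (u : 'I_m -> B) i : good m u (u i).
  exists (fun j => (j == i)%:R); rewrite (bigD1 i) //= eqxx scale1r big1 ?addr0 //.
  by move=> j /negPf ->; rewrite scale0r.
have good0 m (u : 'I_m -> B) : good m u 0.
  by exists (fun _ => 0); rewrite big1 // => i _; rewrite scale0r.
elim: N => [|N [m [u [hu su]]]].
  exists 1%N, (fun _ => 1); split=> [i|b hb]; first exact: fil1.
  rewrite -/(good _ _ _); move e0: 0%N hb => M hb; elim: hb e0 => // {M b}.
  - by move=> _; exact: (goodG 1%N (fun _ => 1) 0).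
  - by move=> M a b _ ha _ hb e; apply: (goodD); auto.
  - by move=> M c b _ hb e; apply: (goodZ); auto.
pose I := ('I_m + 'I_n * 'I_m)%type.
pose v (i : 'I_#|{: I}|) := match enum_val i with inl j => u j | inr p => y p.1 * u p.2 end.
have vE (t : I) : good _ v (match t with inl j => u j | inr p => y p.1 * u p.2 end).
  by have := goodG _ v (enum_rank t); rewrite /v enum_rankK.
exists #|{: I}|, v; split.
  by move=> i; rewrite /v; case: (enum_val i) => [j|p]; [apply/filS|apply/filY].
move=> b /fil_decomp [c [e [hc he ->]]]; rewrite -/(good _ _ _); apply: (goodD).
  apply: (big_ind (good _ v)) => // [|j _]; first exact: goodD.
  have [a ->] := su _ (hc j); rewrite mulr_sumr.
  apply: (big_ind (good _ v)) => // [|i _]; first exact: goodD.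
  by rewrite -scalerAr; apply: (goodZ); apply: (vE (inr (j, i))).
have [a ->] := su _ he; apply: (big_ind (good _ v)) => // [|i _]; first exact: goodD.
by apply: (goodZ); apply: (vE (inl i)).
Qed.

Lemma fil_exhaust b : exists N, fil y N b.
Proof.
elim: (geny b) => {b} [j|c|a b _ [N ha] _ [M hb]|a b _ [N ha] _ [M hb]].
- by exists 1%N; apply: fil_gen.
- by exists 0%N; apply/filZ/fil1.
- exists (maxn N M); apply: filD.
    by apply: fil_le ha; rewrite leq_maxl.
  by apply: fil_le hb; rewrite leq_maxr.
- by exists (N + M)%N; apply: filM.
Qed.

(** A basis of degree at most N spans: normality pushes every higher degree down, at the cost of
    coefficients in k[x]. *)
Lemma normal_span I m (x : 'I_m -> B) N : ideal_pred I -> normal y I x N ->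
  exists q (u : 'I_q -> B), forall b, exists F : 'I_q -> {mpoly k[m]},
    I (b - \sum_i evalB x (F i) * u i).
Proof.
move=> hI hx; have [q [u [hu su]]] := fil_span N; exists q, u.
pose good b := exists F : 'I_q -> {mpoly k[m]}, I (b - \sum_i evalB x (F i) * u i).
have goodD a b : good a -> good b -> good (a + b).
  move=> [F hF] [G hG]; exists (fun i => F i + G i).
  rewrite (eq_bigr (fun i => evalB x (F i) * u i + evalB x (G i) * u i)).
    by rewrite big_split; apply: ideal_congrD.
  by move=> i _; rewrite evalBD mulrDl.
have goodX j b : good b -> good (x j * b).
  move=> [F hF]; exists (fun i => 'X_j * F i).
  rewrite (eq_bigr (fun i => x j * (evalB x (F i) * u i))).
    by rewrite -mulr_sumr -mulrBr; case: hI => _ _; apply.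
  by move=> i _; rewrite evalBM evalBX mulrA.
have goodN b : fil y N b -> good b.
  move=> /su [c ->]; exists (fun i => (c i)%:MP).
  rewrite [X in _ - X](eq_bigr (fun i => c i *: u i)) ?subrr; first by case: hI.
  by move=> i _; rewrite evalBC mulr_algl.
have goodF r b : fil y (N + r) b -> good b.
  elim: r b => [|r IH] b; first by rewrite addn0; apply: (goodN).
  rewrite addnS => /(normalD hI hx) [c [e [hc he h]]].
  suff [F hF] : good (\sum_j x j * c j + e) by exists F; apply: ideal_trans h hF.
  apply: (goodD); last exact: IH.
  have good0 : good 0.
    by apply: (goodN); apply: fil0.
  by apply: (big_ind good) => // j _; apply/goodX/IH.
move=> b; have [M hM] := fil_exhaust b; apply: (goodF M).
by apply: fil_le hM; rewrite leq_addl.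
Qed.

Lemma normal_integral I m (x : 'I_m -> B) N : ideal_pred I -> normal y I x N ->
  forall b, integral_mod (img x) I b.
Proof.
move=> hI hx; have [q [u hu]] := normal_span hI hx.
apply: (integral_of_span (u := u)) => //; first exact: img_subring.
by move=> b; have [F hF] := hu b; exists (fun i => evalB x (F i)); split=> // i; exists (F i).
Qed.

Lemma normal_sub I J m (x : 'I_m -> B) N : (forall b, I b -> J b) ->
  normal y I x N -> normal y J x N.
Proof.
by move=> IJ h b /h [c [e [hc he hI]]]; exists c, e; split=> //; apply: IJ.
Qed.

Lemma evalB0_notin Q (x : 'I_0 -> B) F : prime Q -> F != 0 -> ~ Q (evalB x F).
Proof.
move=> pQ F0; rewrite (mpoly0_const F) evalBC => h; apply: (prime_proper pQ).
have F00 : F@_0 != 0 by apply: contraNneq F0 => h0; rewrite (mpoly0_const F) h0.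
have [_ _ QM] := prime_ideal pQ.
by have := QM ((F@_0)^-1%:A) _ h; rewrite mulr_algl scalerA mulVf // scale1r.
Qed.

(** By integrality, a strict step from P_0 to P_1 puts into P_1 a polynomial in x that is not in
    P_0. This nonzero relation lets one form be dropped modulo P_1, so each step of the chain costs
    a form. *)
Lemma chain_bound m (x : 'I_m -> B) N l (P : nat -> B -> Prop) :
  (forall i, lin y (x i)) -> normal y (P 0%N) x N ->
  (forall i, (i <= l)%N -> prime (P i)) ->
  (forall i, (i < l)%N -> strict_sub (P i) (P i.+1)) -> (l <= m)%N.
Proof.
elim: m x N l P => [|m IH] x N [|l] P linx hx pP sP //.
all: have p0 := pP 0%N isT; have p1 := pP 1%N isT.
all: have [sub [b [P1b nP0b]]] := sP 0%N isT.
all: have hint := normal_integral (prime_ideal p0) hx.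
all: have [_ [c [[F ->] nF hF]]] := integral_meets p0 (hint b) nP0b.
all: have PF : P 1%N (evalB x F)
  by apply: (ideal_congr_mem (prime_ideal p1) (sub _ hF)); case: (prime_ideal p1) => _ _; apply.
all: have F0 : F != 0
  by apply: contra_not_neq nF => ->; rewrite -mpolyC0 evalBC scale0r; case: (prime_ideal p0).
  by case: (evalB0_notin p1 F0 PF).
have [x' [N' [linx' hx']]] := normal_drop (prime_ideal p1) kinf linx (normal_sub sub hx) F0 PF.
apply: (IH x' N' l (fun i => P i.+1)) => //.
- by move=> i il; apply: pP.
- by move=> i il; apply: sP.
Qed.

(** A nonzero relation modulo Q would leave d-1 normal forms, too few for a chain of length d above
    Q. *)
Lemma normal_indep I Q d (x : 'I_d -> B) N F :
  (forall i, lin y (x i)) -> normal y I x N -> (forall b, I b -> Q b) ->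
  prime Q -> dim_ge all_of Q d -> Q (evalB x F) -> F = 0.
Proof.
move=> linx hx IQ pQ /(dim_ge_prime_chain pQ) [P [pP sP P0]] QF.
apply/eqP; apply/negPn/negP => F0.
have hxQ := normal_sub IQ hx.
case: d => [|d] in x linx hx P pP sP P0 F QF F0 hxQ *.
  by case: (evalB0_notin pQ F0 QF).
have [x' [N' [linx' hx']]] := normal_drop (prime_ideal pQ) kinf linx hxQ F0 QF.
suff : (d.+1 <= d)%N by rewrite ltnn.
by apply: (chain_bound (P := P) linx') => //; rewrite P0; exact: hx'.
Qed.

Definition kill m (i : nat) (F : {mpoly k[m]}) : {mpoly k[m]} :=
  mmap (@mpolyC m k) (fun j : 'I_m => if (j < i)%N then 0 else 'X_j) F.

Lemma kill_kill m i F : @kill m i.+1 (kill i F) = kill i.+1 F.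
Proof.
rewrite /kill rmorph_mmap; apply: eq_mmap => [c|j] /=; first by rewrite mmapC.
case: ifP => [ji|ji]; last by rewrite mmap_XU.
by rewrite rmorph0 (ltn_trans ji) //.
Qed.

(** The chain of coordinate primes (X_0, ..., X_{i-1}) of the polynomial ring k[x], realized as
    kernels of [kill i], is lifted to B. *)
Lemma indep_dim_ge m (x : 'I_m -> B) : (forall F, evalB x F = 0 -> F = 0) ->
  (forall b, integral_mod (img x) only_zero b) -> dim_ge (@all_of k B) only_zero m.
Proof.
move=> indep hint.
have inj F G : evalB x F = evalB x G -> F = G.
  move=> h; apply/eqP; rewrite -subr_eq0; apply/eqP/indep.
  by rewrite /evalB rmorphB /= -/(evalB x F) h subrr.
pose P i b := exists F, b = evalB x F /\ kill i F = 0.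
have [||||Q [pQ sQ _]] := @chain_lift k B (img x) (img_subring x) hint m P only_zero.
- move=> i _; split; first by move=> _ [F [-> _]]; exists F.
  split; first by exists 0; rewrite /evalB /kill !rmorph0.
  split.
    by move=> _ _ [F [-> hF]] [G [-> hG]]; exists (F + G);
       rewrite evalBD /kill rmorphD /= -!/(kill _ _) hF hG addr0.
  split.
    by move=> _ _ [F ->] [G [-> hG]]; exists (F * G);
       rewrite evalBM /kill rmorphM /= -!/(kill _ _) hG mulr0.
  split.
    move=> [F [e hF]]; have : F = 1 by apply: inj; rewrite -e /evalB rmorph1.
    by move=> F1; move: hF; rewrite F1 /kill rmorph1 => /eqP; rewrite oner_eq0.
  move=> _ _ [F ->] [G ->] [H [e]]; have <- : F * G = H by apply: inj; rewrite -e evalBM.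
  rewrite /kill rmorphM /= -!/(kill _ _) => /eqP; rewrite mulf_eq0.
  by case/orP => /eqP h; [left; exists F|right; exists G].
- move=> i im; split.
    by move=> _ [F [-> hF]]; exists F; split=> //; rewrite -kill_kill hF /kill rmorph0.
  exists (x (Ordinal im)); split.
    by exists 'X_(Ordinal im); rewrite evalBX /kill mmap_XU //= ltnSn.
  move=> [F []]; rewrite -evalBX => /inj <-.
  rewrite /kill mmap_XU //= ltnn => /eqP; apply/negP.
  by rewrite -msize_poly_eq0 msizeX.
- exact: ideal_only_zero.
- by move=> b _ ->; exists 0; rewrite /evalB /kill !rmorph0.
by exists Q.
Qed.

Lemma dim_ge_le S I l l' : (l' <= l)%N -> @dim_ge k B S I l -> dim_ge S I l'.
Proof.
move=> ll [P [pP sP]]; exists P; split=> i hi; first by apply: pP; apply: leq_trans ll.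
by apply: sP; apply: leq_trans ll.
Qed.

(** Starting from y itself, forms are dropped as long as more than d remain: independent ones would
    give dimension above d. *)
Lemma noether d : ~ dim_ge (@all_of k B) only_zero d.+1 ->
  exists (x : 'I_d -> B) N, (forall i, lin y (x i)) /\ normal y only_zero x N.
Proof.
move=> nd.
pose ok m := exists (x : 'I_m -> B) N, (forall i, lin y (x i)) /\ normal y only_zero x N.
have okn : ok n.
  exists y, 0%N; split; first exact: lin_y.
  have hI := ideal_only_zero B.
  move=> b /fil_decomp [c [e [hc he ->]]]; apply: (redD hI); last exact: (red_low hI).
  by apply: (red_sum hI) => j _; apply: (red_x hI).
have drop e : ok (d + e.+1)%N -> ok (d + e)%N.
  rewrite addnS => -[x [N [linx hx]]]; apply: NNPP => hn.
  apply: nd; apply: (@dim_ge_le _ _ (d + e).+1); first by rewrite ltnS leq_addr.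
  apply: (indep_dim_ge (x := x)); last exact: normal_integral (ideal_only_zero _) hx.
  move=> F hF; apply/eqP; apply/negPn/negP => F0; apply: hn.
  have [x2 [N2 h2]] := normal_drop (ideal_only_zero B) kinf linx hx F0 hF.
  by exists x2, N2.
have [m md [x [N [linx hx]]]] : exists2 m, (m <= d)%N & ok m.
  have [nd'|dn] := leqP n d; first by exists n.
  exists d => //; move: okn; rewrite -(subnKC (ltnW dn)).
  by elim: (n - d)%N => [|e IH]; rewrite ?addn0 // => /drop.
(* If fewer than d forms remain, zeros fill up the family; they do not affect normality. *)
rewrite -(subnKC md); set r := (d - m)%N.
exists (fun i : 'I_(m + r) => match split i with inl j => x j | inr _ => 0 end), N; split.
  move=> i; case: (split i) => // _.
  by exists (fun _ => 0); rewrite big1 // => j _; rewrite scale0r.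
move=> b /hx [c [e [hc he h]]].
exists (fun i : 'I_(m + r) => match split i with inl j => c j | inr _ => 0 end), e; split=> //.
  by move=> i; case: (split i) => // _; exact: fil0.
rewrite big_split_ord /= [X in _ + X + _]big1 ?addr0.
  rewrite (eq_bigr (fun j => x j * c j)) // => j _.
  by rewrite (unsplitK (inl j)).
by move=> j _; rewrite (unsplitK (inr j)) mul0r.
Qed.

End DimensionTheory.

(** * Generic coefficients *)

Section GenericCoefficients.
Variables (k : fieldType) (n : nat) (B : comAlgType k) (y : 'I_n -> B).

(** Validity off a hypersurface. Carrying the polynomial along makes conjunction a product. *)
Definition generic e (P : 'M[k]_(e, n) -> Prop) :=
  exists f : {mpoly k[(e * n)%N]}, f != 0 /\
    forall c : 'M[k]_(e, n), f.@[fun t => mxvec c 0 t] != 0 -> P c.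

Lemma generic_imp e (P Q : 'M[k]_(e, n) -> Prop) :
  (forall c, P c -> Q c) -> generic P -> generic Q.
Proof. by move=> PQ [f [f0 fP]]; exists f; split=> // c /fP /PQ. Qed.

Lemma generic_true e (P : 'M[k]_(e, n) -> Prop) : (forall c, P c) -> generic P.
Proof. by move=> hP; exists 1; split; [exact: oner_neq0|]. Qed.

Lemma generic_and e (P Q : 'M[k]_(e, n) -> Prop) :
  generic P -> generic Q -> generic (fun c => P c /\ Q c).
Proof.
move=> [f [f0 fP]] [g [g0 gQ]]; exists (f * g); split; first by rewrite mulf_neq0.
by move=> c; rewrite mevalM mulf_eq0 negb_or => /andP [/fP ? /gQ ?].
Qed.

Lemma generic_all e m (P : 'I_m -> 'M[k]_(e, n) -> Prop) :
  (forall i, generic (P i)) -> generic (fun c => forall i, P i c).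
Proof.
move=> hP; have /fin_all_exists [f hf] := hP.
exists (\prod_i f i); split; first by apply/prodf_neq0 => i _; case: (hf i).
move=> c; rewrite rmorph_prod /= => /prodf_neq0 h i.
by case: (hf i) => _; apply; apply: h.
Qed.

(* The variables are the coefficients c_ij, followed by one Z_i for each row. *)
Definition vmap (R : comNzRingType) m (C : 'M[R]_(m, n)) (z : 'I_m -> R)
    (v : 'I_(m * n + m)) : R :=
  match split v with inl t => mxvec C 0 t | inr i => z i end.

Definition cvar m (i : 'I_m) (j : 'I_n) : 'I_(m * n + m) := lshift m (mxvec_index i j).
Definition zvar m (i : 'I_m) : 'I_(m * n + m) := rshift (m * n) i.

Lemma vmap_c (R : comNzRingType) m (C : 'M[R]_(m, n)) z i j : vmap C z (cvar i j) = C i j.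
Proof. by rewrite /vmap /cvar (unsplitK (inl _)) mxvecE. Qed.

Lemma vmap_z (R : comNzRingType) m (C : 'M[R]_(m, n)) z i : vmap C z (zvar i) = z i.
Proof. by rewrite /vmap /zvar (unsplitK (inr _)). Qed.

Lemma var_ind m (P : 'I_(m * n + m) -> Prop) :
  (forall i j, P (cvar i j)) -> (forall i, P (zvar i)) -> forall v, P v.
Proof.
move=> hc hz v; rewrite -(splitK v); case: (split v) => [t|i] /=; last exact: hz.
by case/mxvec_indexP: t => i j; apply: hc.
Qed.

Definition zform (B' : comNzRingType) (e : {rmorphism B -> B'}) m (C : 'M[B']_(m, n))
  (i : 'I_m) : B' := \sum_j C i j * e (y j).

(** Substitution of C for c and of the corresponding forms for Z. The target is left arbitrary,
    since the same relations are read in B[c] and in (B/Q)[c]. *)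
Definition phi (B' : comNzRingType) (e : {rmorphism B -> B'}) m (C : 'M[B']_(m, n)) :
    {mpoly k[(m * n + m)%N]} -> B' :=
  mmap (e \o in_alg B) (vmap C (zform e C)).

HB.instance Definition _ (B' : comNzRingType) (e : {rmorphism B -> B'}) m
    (C : 'M[B']_(m, n)) :=
  GRing.RMorphism.copy (phi e C) (mmap (e \o in_alg B) (vmap C (zform e C))).

(** * Perturbing the coefficients of a normal family *)

Section Transition.
Variables (d : nat) (x : 'I_d -> B) (c0 : 'I_d -> 'I_n -> k).
Hypothesis xE : forall i, x i = \sum_j c0 i j *: y j.
Variables (a b : nat) (u : 'I_a -> B) (v : 'I_b -> B).
Variables (tau : 'I_n -> 'M[k]_(a, b)) (beta : 'I_d -> 'M[k]_(b, a)) (gam : 'M[k]_(b, a)).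
Hypothesis htau : forall j p, y j * u p = \sum_q tau j p q *: v q.
Hypothesis hv : forall q,
  v q = \sum_i x i * (\sum_p beta i q p *: u p) + \sum_p gam q p *: u p.

Section Map.
Variables (R B' : comNzRingType) (h : {rmorphism k -> R}) (g : {rmorphism R -> B'}).
Variable e : {rmorphism B -> B'}.
Hypothesis gh : forall t, g (h t) = e (t%:A).

(** Here u spans degree N, v degree N+1, tau_j is multiplication by y_j, and beta, gam record
    normality of x. Replacing x_i by z_i changes sum_i x_i beta_i U by sum_i (x_i - z_i) beta_i U, a
    combination of the tau_j V; moving it to the side of V gives this matrix, which is the identity
    at c = c0. *)
Definition trans (c : 'I_d -> 'I_n -> R) : 'M[R]_b :=
  1%:M - \sum_i \sum_j (h (c0 i j) - c i j) *: map_mx h (beta i *m tau j).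

Let U : 'cV[B']_a := \col_p e (u p).
Let V : 'cV[B']_b := \col_q e (v q).

Let scaleE m q (M : 'M[k]_(m, q)) (w : 'I_q -> B) i :
  (map_mx (g \o h) M *m \col_p e (w p)) i 0 = e (\sum_p M i p *: w p).
Proof.
rewrite mxE rmorph_sum; apply: eq_bigr => p _; rewrite !mxE /= gh -rmorphM.
by rewrite mulr_algl.
Qed.

Lemma tau_mul j : e (y j) *: U = map_mx (g \o h) (tau j) *m V.
Proof. by apply/colP => p; rewrite scaleE -htau !mxE rmorphM. Qed.

Lemma V_decomp :
  V = \sum_i e (x i) *: (map_mx (g \o h) (beta i) *m U) + map_mx (g \o h) gam *m U.
Proof.
apply/colP => q; rewrite mxE hv rmorphD mxE scaleE; congr (_ + _).
rewrite rmorph_sum summxE; apply: eq_bigr => i _.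
by rewrite mxE scaleE rmorphM.
Qed.

Lemma trans_mul (c : 'I_d -> 'I_n -> R) (z : 'I_d -> B') :
  (forall i, z i = \sum_j g (c i j) * e (y j)) ->
  map_mx g (trans c) *m V =
    \sum_i z i *: (map_mx (g \o h) (beta i) *m U) + map_mx (g \o h) gam *m U.
Proof.
move=> hz; rewrite /trans map_mxB map_mx1 mulmxBl mul1mx {1}V_decomp addrAC.
congr (_ + _); rewrite map_mx_sum mulmx_suml -sumrB; apply: eq_bigr => i _.
rewrite map_mx_sum mulmx_suml.
have -> : \sum_j (map_mx g ((h (c0 i j) - c i j) *: map_mx h (beta i *m tau j)) *m V) =
    (e (x i) - z i) *: (map_mx (g \o h) (beta i) *m U).
  rewrite xE hz rmorph_sum -sumrB scaler_suml; apply: eq_bigr => j _.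
  rewrite map_mxZ -scalemxAl -map_mx_comp map_mxM -mulmxA -tau_mul.
  rewrite -scalemxAr scalerA; congr (_ *: _).
  by rewrite rmorphB gh mulrBl -rmorphM mulr_algl.
by rewrite -scalerBl opprB addrC subrK.
Qed.

Lemma trans_adj (c : 'I_d -> 'I_n -> R) (z : 'I_d -> R) :
  (forall i, g (z i) = \sum_j g (c i j) * e (y j)) ->
  g (\det (trans c)) *: V = map_mx g (\adj (trans c) *m
     (\sum_i z i *: map_mx h (beta i) + map_mx h gam)) *m U.
Proof.
move=> hz; rewrite map_mxM -mulmxA map_mxD mulmxDl.
rewrite map_mx_sum mulmx_suml (eq_bigr (fun i => g (z i) *: (map_mx (g \o h) (beta i) *m U))).
  rewrite -map_mx_comp -(trans_mul hz) mulmxA -map_mxM mul_adj_mx.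
  by rewrite map_scalar_mx mul_scalar_mx.
by move=> i _; rewrite map_mxZ -scalemxAl -map_mx_comp.
Qed.

End Map.

Lemma trans_base (R T : comNzRingType) (h : {rmorphism k -> R}) (s : {rmorphism R -> T})
    (c : 'I_d -> 'I_n -> R) :
  (forall i j, s (c i j) = s (h (c0 i j))) -> map_mx s (trans h c) = 1%:M.
Proof.
move=> hc; rewrite /trans map_mxB map_mx1 map_mx_sum big1 ?subr0 // => i _.
rewrite map_mx_sum big1 // => j _.
by rewrite map_mxZ rmorphB /= hc subrr scale0r.
Qed.

End Transition.

Lemma transition_data d N (x : 'I_d -> B) : normal y only_zero x N ->
  exists a b (u : 'I_a -> B) (v : 'I_b -> B) (tau : 'I_n -> 'M[k]_(a, b))
     (beta : 'I_d -> 'M[k]_(b, a)) (gam : 'M[k]_(b, a)),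
  [/\ forall p, fil y N (u p),
      exists t : 'I_a -> k, 1 = \sum_p t p *: u p,
      forall w, fil y N.+1 w -> exists t : 'I_b -> k, w = \sum_q t q *: v q,
      forall j p, y j * u p = \sum_q tau j p q *: v q
    & forall q, v q = \sum_i x i * (\sum_p beta i q p *: u p) + \sum_p gam q p *: u p].
Proof.
move=> hx; have [a [u [hu su]]] := fil_span y N; have [b [v [hv sv]]] := fil_span y N.+1.
have htau j p : exists t : 'I_b -> k, y j * u p = \sum_q t q *: v q.
  by apply: sv; apply: filY.
have /fin_all_exists [tau Etau] : forall j, exists t : 'I_a -> 'I_b -> k,
    forall p, y j * u p = \sum_q t p q *: v q.
  by move=> j; apply: fin_all_exists (htau j).
have hbg q : exists bg : ('I_d -> 'I_a -> k) * ('I_a -> k),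
    v q = \sum_i x i * (\sum_p bg.1 i p *: u p) + \sum_p bg.2 p *: u p.
  have [c [w [hc hw /eqP]]] := hx _ (hv q); rewrite subr_eq0 => /eqP ->.
  have /fin_all_exists [bt hbt] := fun i => su _ (hc i).
  have [gm ->] := su _ hw; exists (bt, gm); congr (_ + _).
  by apply: eq_bigr => i _; rewrite hbt.
have /fin_all_exists [bg Ebg] := hbg.
exists a, b, u, v, (fun j => \matrix_(p, q) tau j p q),
  (fun i => \matrix_(q, p) (bg q).1 i p), (\matrix_(q, p) (bg q).2 p); split=> //.
- by apply: su; apply: fil_le (fil1 y).
- by move=> j p; rewrite Etau; apply: eq_bigr => q _; rewrite mxE.
- move=> q; rewrite Ebg; congr (_ + _); last by apply: eq_bigr => p _; rewrite mxE.
  by apply: eq_bigr => i _; congr (_ * _); apply: eq_bigr => p _; rewrite mxE.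
Qed.

(** Where the determinant of [trans] is nonzero, V can be solved for in terms of the new forms and
    degree N. The bound N does not change. *)
Lemma normal_open d r N (x : 'I_d -> B) :
  (forall i, lin y (x i)) -> normal y only_zero x N ->
  generic (fun c : 'M[k]_(d + r, n) =>
    normal y only_zero (fun i => \sum_j c (lshift r i) j *: y j) N).
Proof.
move=> /fin_all_exists [c0 xE] hx.
have [a [b [u [v [tau [beta [gam [hu _ sv htau hv]]]]]]]] := transition_data hx.
pose R := {mpoly k[((d + r) * n)%N]}.
pose T := trans c0 tau beta (@mpolyC ((d + r) * n) k)
  (fun i j => 'X_(mxvec_index (lshift r i) j) : R).
pose ev (c : 'M[k]_(d + r, n)) := meval (fun t => mxvec c 0 t) : R -> k.
have evX c i j : ev c 'X_(mxvec_index i j) = c i j by rewrite /ev mevalXU mxvecE.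
exists (\det T); split.
  (* The determinant is not the zero polynomial: it is 1 at the coefficients of x, whatever the
     other r rows are. *)
  pose c := \matrix_(i < d + r, j < n)
    match split i with inl i' => c0 i' j | inr _ => 0 end.
  apply/eqP => h; have : ev c (\det T) = 0 by rewrite h /ev rmorph0.
  rewrite /ev -det_map_mx trans_base => [|i j].
    by rewrite det1 => /eqP; rewrite oner_eq0.
  by rewrite [LHS]evX mxE (unsplitK (inl i)); apply/esym/mevalC.
move=> c hc w /sv [t ->].
have hI := ideal_only_zero B.
apply: (red_sum hI) => q _; apply: (redZ hI).
pose D := ev c (\det T).
pose A := map_mx (ev c) (\adj T).
pose z i := \sum_j c (lshift r i) j *: y j.
pose g : {rmorphism R -> B} := in_alg B \o meval (fun t => mxvec c 0 t).
have gE F : g F = (ev c F)%:A by [].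
pose W q := \sum_i z i * (\sum_p beta i q p *: u p) + \sum_p gam q p *: u p.
have redW q' : red y only_zero z N (W q').
  apply: redD => //; last by apply: (red_low hI); apply: fil_sum => p _; apply: filZ.
  apply: (red_sum hI) => i _; apply: (red_x hI).
  by apply: fil_sum => p _; apply: filZ.
have gh s : g (@mpolyC _ k s) = idfun (s%:A) by rewrite gE; congr _%:A; apply: mevalC.
have hz i : z i = \sum_j g ('X_(mxvec_index (lshift r i) j)) * idfun (y j).
  by apply: eq_bigr => j _; rewrite gE evX mulr_algl.
have E := trans_mul xE htau hv gh hz; rewrite -/T in E.
have {E} : map_mx g T *m (\col_q v q) = \col_q W q.
  rewrite E; apply/colP => q'; rewrite !mxE summxE /W; congr (_ + _).
    apply: eq_bigr => i _; rewrite !mxE; congr (_ * _); apply: eq_bigr => p _.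
    by rewrite !mxE -mulr_algl; congr (_ * _); apply: gh.
  by apply: eq_bigr => p _; rewrite !mxE -mulr_algl; congr (_ * _); apply: gh.
move=> /(congr1 (mulmx (map_mx g (\adj T)))).
rewrite mulmxA -map_mxM mul_adj_mx map_scalar_mx mul_scalar_mx => /colP /(_ q).
rewrite !mxE gE mulr_algl => E.
rewrite -[v q]scale1r -(mulVf hc) -scalerA; apply: (redZ hI).
rewrite -[X in red _ _ _ _ X]/(D *: v q) E; apply: (red_sum hI) => q' _.
by rewrite !mxE gE mulr_algl; apply: (redZ hI).
Qed.

(** By Cramer, det T times V is a matrix over k[c,Z] applied to U. As y_j U = tau_j V,
    multiplication of U by det T times z_0 is then the matrix M, and the determinant of the
    difference kills U, hence kills 1. *)
Lemma generic_relation d N (x : 'I_d -> B) :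
  (forall i, lin y (x i)) -> normal y only_zero x N ->
  exists F : {mpoly k[(d.+1 * n + d.+1)%N]}, F != 0 /\
    forall (B' : comNzRingType) (e : {rmorphism B -> B'}) (C : 'M[B']_(d.+1, n)),
      phi e C F = 0.
Proof.
move=> /fin_all_exists [c0 xE] hx.
have [a [b [u [v [tau [beta [gam [_ [t ht] _ htau hv]]]]]]]] := transition_data hx.
pose R := {mpoly k[(d.+1 * n + d.+1)%N]}.
pose h : {rmorphism k -> R} := @mpolyC _ k.
pose c i j : R := 'X_(cvar (lift ord0 i) j).
pose z i : R := 'X_(zvar (lift (ord0 : 'I_d.+1) i)).
pose T := trans c0 tau beta h c.
pose A := \adj T *m (\sum_i z i *: map_mx h (beta i) + map_mx h gam).
pose M := \sum_j ('X_(cvar ord0 j) : R) *: (map_mx h (tau j) *m A).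
exists (\det ((\det T * 'X_(zvar ord0))%:M - M)); split.
  (* At this point, with Z_0 = 1 and the other Z_i zero, T is the identity and M vanishes, so the
     determinant is 1. *)
  pose C0 := \matrix_(i < d.+1, j < n) if unlift ord0 i is Some i' then c0 i' j else 0.
  pose s : {rmorphism R -> k} := meval (vmap C0 (fun i => (i == ord0)%:R)).
  apply/eqP => h0; have : s (\det ((\det T * 'X_(zvar ord0))%:M - M)) = 0.
    by rewrite h0 rmorph0.
  rewrite -det_map_mx map_mxB map_scalar_mx rmorphM -det_map_mx trans_base.
    rewrite det1 mul1r [s _]mevalXU vmap_z eqxx map_mx_sum big1 ?subr0 ?det1.
      by move/eqP; rewrite oner_eq0.
    by move=> j _; rewrite map_mxZ [s _]mevalXU vmap_c mxE unlift_none scale0r.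
  move=> i j; rewrite [LHS]mevalXU vmap_c mxE liftK.
  by apply/esym/mevalC.
move=> B' e C; set F := \det _.
pose g : {rmorphism R -> B'} := phi e C.
have gh s : g (h s) = e s%:A by apply: mmapC.
have gc i j : g 'X_(cvar i j) = C i j by rewrite [LHS]mmap_XU ?rmorph1 // vmap_c.
have gz i : g 'X_(zvar i) = \sum_j C i j * e (y j) by rewrite [LHS]mmap_XU ?rmorph1 // vmap_z.
have hz i : g (z i) = \sum_j g (c i j) * e (y j).
  by rewrite gz; apply: eq_bigr => j _; rewrite gc.
have E := trans_adj xE htau hv gh hz.
have FU : g F *: (\col_p e (u p)) = 0.
  rewrite -mul_scalar_mx -map_scalar_mx -mul_adj_mx map_mxM -mulmxA.
  suff -> : map_mx g ((\det T * 'X_(zvar ord0))%:M - M) *m (\col_p e (u p)) = 0.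
    by rewrite mulmx0.
  rewrite map_mxB mulmxBl map_scalar_mx mul_scalar_mx rmorphM gz.
  apply/eqP; rewrite subr_eq0; apply/eqP.
  move: (g (\det T)) E => gT E.
  rewrite mulr_sumr scaler_suml map_mx_sum mulmx_suml; apply: eq_bigr => j _.
  rewrite map_mxZ gc -scalemxAl map_mxM -mulmxA -E -map_mx_comp.
  rewrite -scalemxAr -(tau_mul htau gh) !scalerA; congr (_ *: _).
  by rewrite mulrCA mulrA.
have : g F * e 1 = 0.
  move: (g F) FU => gF FU; rewrite ht rmorph_sum mulr_sumr big1 // => p _.
  move/colP/(_ p): FU; rewrite !mxE => FU.
  by rewrite -mulr_algl rmorphM mulrCA FU mulr0.
by rewrite rmorph1 mulr1.
Qed.

End GenericCoefficients.

(** * Finitely many primes of maximal dimension *)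

Section PrimeQuotient.
Variables (k : fieldType) (B : comAlgType k) (Q : B -> Prop).
Hypothesis pQ : prime Q.

Definition prime_mem : pred B := fun b => boolp.asbool (Q b).

Lemma prime_memP b : prime_mem b <-> Q b.
Proof. by split=> /boolp.asboolP. Qed.

Lemma prime_mem_ideal : idealr_closed prime_mem.
Proof.
have [Q0 QD QM] := prime_ideal pQ; split.
- by apply/prime_memP.
- by apply/negP => /prime_memP; apply: prime_proper.
- move=> a u v /prime_memP hu /prime_memP hv; apply/prime_memP.
  by apply: QD => //; apply: QM.
Qed.

Lemma prime_mem_prime : prime_idealr_closed prime_mem.
Proof.
by move=> u v /prime_memP /(primeM pQ) [] ?; apply/orP; [left|right]; apply/prime_memP.
Qed.

HB.instance Definition _ := isIdealr.Build B prime_mem prime_mem_ideal.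
HB.instance Definition _ := isPrimeIdealrClosed.Build B prime_mem prime_mem_prime.

Let prime_I : prime_idealr B := PrimeIdealr.clone B prime_mem _.

Definition prime_quot := {ideal_quot prime_I}.
HB.instance Definition _ := GRing.ComNzRing.on prime_quot.

(** An integral domain structure carries a unit predicate and an inverse; both are decided
    classically here. *)
Let unit_quot : {pred prime_quot} := fun u => boolp.asbool (exists v, v * u = 1).
Let unit_quotP u : unit_quot u <-> exists v, v * u = 1.
Proof. by split=> /boolp.asboolP. Qed.
Let inv_quot (u : prime_quot) : prime_quot :=
  if boolp.pselect (exists v, v * u = 1) is left h then xchoose
     (let: ex_intro v e := h in ex_intro (fun v => v * u == 1) v (introT eqP e)) else u.
Let mulV_quot : {in unit_quot, left_inverse 1 inv_quot *%R}.
Proof.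
move=> u /unit_quotP hu; rewrite /inv_quot; case: boolp.pselect => // h.
by apply/eqP; apply: (xchooseP (P := fun v => v * u == 1)).
Qed.
Let unit_quotPl (x z : prime_quot) : z * x = 1 -> unit_quot x.
Proof. by move=> e; apply/unit_quotP; exists z. Qed.
Let inv_quot_out : {in [predC unit_quot], inv_quot =1 id}.
Proof.
move=> u /negP hu; rewrite /inv_quot; case: boolp.pselect => // h.
by case: hu; apply/unit_quotP.
Qed.
HB.instance Definition _ :=
  GRing.ComNzRing_hasMulInverse.Build prime_quot mulV_quot unit_quotPl inv_quot_out.

Let quot_integral : GRing.integral_domain_axiom prime_quot.
Proof. by move=> u v; apply: Quotient.rquot_IdomainAxiom. Qed.
HB.instance Definition _ := GRing.ComUnitRing_isIntegral.Build prime_quot quot_integral.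

Lemma prime_quotient : exists (D : idomainType) (pi : {rmorphism B -> D}),
  (forall b, pi b = 0 <-> Q b) /\ (forall t, exists b, pi b = t).
Proof.
pose pi (b : B) : prime_quot := (\pi_({ideal_quot prime_I}) b)%qT.
have piB : zmod_morphism pi.
  by move=> a b; rewrite /pi (rmorphB (\pi_({ideal_quot prime_I}))%qT).
have piM : monoid_morphism pi.
  split; first by rewrite /pi (rmorph1 (\pi_({ideal_quot prime_I}))%qT).
  by move=> a b; rewrite /pi (rmorphM (\pi_({ideal_quot prime_I}))%qT).
pose m1 := GRing.isZmodMorphism.Build _ _ _ piB.
pose m2 := GRing.isMonoidMorphism.Build _ _ _ piM.
pose pi' : {rmorphism B -> prime_quot} := HB.pack pi m1 m2.
exists prime_quot, pi'; split.
  move=> b; rewrite -prime_memP /=; split.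
    move=> h; have : (b == 0 %[mod {ideal_quot prime_I}])%qT.
      by apply/eqP; rewrite -/(pi b) h -[RHS]/(pi' 0) rmorph0.
    by rewrite -Quotient.idealrBE subr0.
  move=> h; rewrite -(rmorph0 pi'); apply/eqP.
  by rewrite -[_ == _]/(b == 0 %[mod {ideal_quot prime_I}])%qT -Quotient.idealrBE subr0.
by move=> t; exists (repr t); rewrite /= /pi reprK.
Qed.

End PrimeQuotient.

(** * Elements that stay outside a prime under specialization *)

Section Specialization.
Variables (k : fieldType) (B : comAlgType k) (Q : B -> Prop).
Hypothesis hQ : ideal_pred Q.

(** If the b_i are linearly independent modulo Q, one nonzero g_i serves. Otherwise a relation
    eliminates one b_i and shortens the sum, compatibly with taking coefficients and with
    evaluating. *)
Lemma combination_nonvanishing M l (g : 'I_l -> {mpoly k[M]}) (b : 'I_l -> B) :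
  ~ (forall m, Q (\sum_i (g i)@_m *: b i)) ->
  exists f : {mpoly k[M]}, f != 0 /\
    forall v, f.@[v] != 0 -> ~ Q (\sum_i (g i).@[v] *: b i).
Proof.
elim: l g b => [|l IH] g b nQ.
  by case: nQ => m; rewrite big_ord0; case: hQ.
have [ind|] := classic (forall c : 'I_l.+1 -> k, Q (\sum_i c i *: b i) -> forall i, c i = 0).
  have [i gi] : exists i, g i != 0.
    apply: NNPP => hn; case: nQ => m; rewrite big1; first by case: hQ.
    move=> i _; have -> : g i = 0.
      by apply/eqP/negPn/negP => gi; apply: hn; exists i.
    by rewrite mcoeff0 scale0r.
  by exists (g i); split=> // v nv /ind /(_ i) gv; rewrite gv eqxx in nv.
move=> /not_all_ex_not [c hc]; have [Qc nc] := imply_to_and _ _ hc.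
have [i0 /eqP ci] := not_all_ex_not _ _ nc.
have elimE (al : 'I_l.+1 -> k) :
    Q (\sum_i al i *: b i -
       \sum_i (al (lift i0 i) - c (lift i0 i) / c i0 * al i0) *: b (lift i0 i)).
  suff -> : \sum_i al i *: b i -
       \sum_i (al (lift i0 i) - c (lift i0 i) / c i0 * al i0) *: b (lift i0 i) =
       (al i0 / c i0)%:A * \sum_i c i *: b i by case: hQ => _ _; apply.
  rewrite !(bigD1_ord i0) //= mulrDr mulr_algl scalerA divfK // -addrA; congr (_ + _).
  rewrite mulr_sumr -sumrB; apply: eq_bigr => i _.
  rewrite mulr_algl scalerA -scalerBl; congr (_ *: _).
  by ring.
pose g' i := g (lift i0 i) - (c (lift i0 i) / c i0) *: g i0.
have [|f [f0 hf]] := IH g' (fun i => b (lift i0 i)).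
  apply: contra_not nQ => h m.
  apply: (ideal_congr_mem hQ (elimE (fun i => (g i)@_m))).
  have := h m; congr Q; apply: eq_bigr => i _.
  by rewrite mcoeffB mcoeffZ.
exists f; split=> // v /hf; apply: contra_not => h.
apply: (ideal_congr_mem hQ _ h); apply: idealBC => //.
have := elimE (fun i => (g i).@[v]); congr (Q (_ - _)).
by apply: eq_bigr => i _; rewrite mevalB mevalZ.
Qed.

Lemma specialize_notin M (w : {mpoly B[M]}) : ~ (forall m, Q w@_m) ->
  exists f : {mpoly k[M]}, f != 0 /\
    forall v : 'I_M -> k, f.@[v] != 0 -> ~ Q w.@[fun t => (v t)%:A].
Proof.
move=> nQ; pose s := msupp w; pose l := size s.
pose mi (i : 'I_l) := nth 0%MM s i.
have sumE (F : 'X_{1.. M} -> B) : \sum_(m <- s) F m = \sum_(i < l) F (mi i).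
  by rewrite (big_nth 0%MM) big_mkord.
have [|f [f0 hf]] := @combination_nonvanishing M l (fun i => 'X_[mi i]) (fun i => w@_(mi i)).
  apply: contra_not nQ => h m; have := h m; congr Q.
  rewrite -(sumE (fun u => ('X_[u])@_m *: w@_u)).
  rewrite [w in RHS]mpolyE raddf_sum; apply: eq_bigr => u _.
  by rewrite /= mcoeffZ !mcoeffX mulrC; case: eqP => _; rewrite ?mul1r ?scale1r ?mul0r ?scale0r.
exists f; split=> // v /hf; congr (~ Q _).
rewrite -(sumE (fun u => ('X_[u]).@[v] *: w@_u)) mevalE; apply: eq_bigr => u _.
rewrite mevalX -mulr_algl mulrC; congr (_ * _).
by rewrite -[LHS]/(in_alg B _) rmorph_prod; apply: eq_bigr => i _; rewrite rmorphXn.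
Qed.

End Specialization.

Section TopPrimes.
Variables (k : fieldType) (n : nat) (B : comAlgType k) (y : 'I_n -> B) (d : nat).
Hypothesis kinf : infinite_field k.
Hypothesis geny : generates y.
Hypothesis dimB : ~ dim_ge (@all_of k B) only_zero d.+1.

Definition top (Q : B -> Prop) := prime Q /\ dim_ge all_of Q d.

(** A strictly smaller prime would lengthen a chain above Q2 to length d+1. *)
Lemma top_incomparable Q1 Q2 : top Q1 -> top Q2 ->
  (forall b, Q1 b -> Q2 b) -> forall b, Q2 b -> Q1 b.
Proof.
move=> [p1 _] [p2 d2] sub b Q2b; apply: NNPP => nb.
have [P [pP sP P0]] := dim_ge_prime_chain p2 d2.
apply: dimB; exists (fun i => if i is i'.+1 then P i' else Q1); split.
  have pi i : (i <= d.+1)%N -> prime (if i is i'.+1 then P i' else Q1).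
    by case: i => [|i] //; apply: pP.
  move=> i /pi pi1; split=> // _ ->; by case: (prime_ideal pi1).
by case=> [|i] il; [rewrite P0; split=> //; exists b|apply: sP].
Qed.

(** If M elements span B over k[x], there are at most M such primes. For M+1 of them take e_i
    outside Q_i and inside all the others; the e_i are dependent over k[x], and modulo Q_i the
    dependence puts its i-th coefficient into Q_i, where the x are independent. *)
Lemma finitely_many_top : exists K (Q : 'I_K -> B -> Prop),
  (forall i, top (Q i)) /\
  forall Q', top Q' -> exists i, forall b, Q i b <-> Q' b.
Proof.
have [x [N [linx hx]]] := noether kinf geny dimB.
have [M [u hu]] := normal_span geny (ideal_only_zero B) hx.
pose distinct K := exists Q : 'I_K -> B -> Prop, (forall i, top (Q i)) /\
  forall i j, i != j -> ~ (forall b, Q i b <-> Q j b).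
have bound : ~ distinct M.+1.
  move=> [Q [tQ dQ]].
  have pQ i : prime (Q i) by case: (tQ i).
  have sep i j : exists b, i != j -> Q j b /\ ~ Q i b.
    case: (eqVneq i j) => [_|ij]; first by exists 0.
    apply: NNPP => hn; apply: (dQ i j ij) => b.
    have sub : forall b, Q j b -> Q i b.
      by move=> z Qz; apply: NNPP => nz; apply: hn; exists z.
    by split; [apply: top_incomparable sub b|apply: sub].
  have /fin_all_exists [a ha] : forall i, exists a : 'I_M.+1 -> B,
      forall j, i != j -> Q j (a j) /\ ~ Q i (a j).
    by move=> i; apply: fin_all_exists (sep i).
  pose e i := \prod_(j | i != j) a i j.
  have eii i : ~ Q i (e i) by apply: prime_prod => // j ij; case: (ha i j ij).
  have eij i j : i != j -> Q j (e i).
    move=> ij; rewrite /e (bigD1 j) //=; apply: ideal_mulr; first exact: prime_ideal.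
    by case: (ha i j ij).
  have /fin_all_exists [F hF] : forall i, exists F : 'I_M -> {mpoly k[d]},
      e i = \sum_p evalB x (F p) * u p.
    by move=> i; have [F /eqP] := hu (e i); rewrite subr_eq0 => /eqP; exists F.
  (* An extra zero column makes the matrix square and singular. *)
  pose A := \matrix_(i < M.+1, j < M.+1)
    if unlift ord_max j is Some p then F i p else 0.
  have : \det A == 0.
    apply/eqP; rewrite (expand_det_col _ ord_max) big1 // => i _.
    by rewrite mxE unlift_none mul0r.
  case/det0P => w w0 wA; move/negP: w0; apply.
  apply/eqP/rowP => i; rewrite mxE.
  have sum0 : \sum_j evalB x (w 0 j) * e j = 0.
    rewrite (eq_bigr (fun j => \sum_p evalB x (w 0 j * F j p) * u p)); last first.
      by move=> j _; rewrite hF mulr_sumr; apply: eq_bigr => p _; rewrite evalBM mulrA.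
    rewrite exchange_big big1 // => p _; rewrite -mulr_suml.
    move/rowP/(_ (lift ord_max p)): wA; rewrite !mxE => wA.
    have -> : \sum_j evalB x (w 0 j * F j p) =
        evalB x (\sum_j w 0 j * A j (lift ord_max p)).
      rewrite /evalB rmorph_sum; apply: eq_bigr => j _.
      by rewrite mxE liftK.
    by rewrite wA /evalB rmorph0 mul0r.
  have Qi : Q i (evalB x (w 0 i) * e i).
    move: sum0; rewrite (bigD1 i) //= => /eqP; rewrite addr_eq0 => /eqP ->.
    apply: idealN; first exact: prime_ideal.
    apply: ideal_sum; first exact: prime_ideal.
    by move=> j ji; case: (prime_ideal (pQ i)) => _ _; apply; apply: eij.
  case: (primeM (pQ i) Qi) => [hw|/eii //].
  apply: (normal_indep kinf geny linx hx _ (pQ i) _ hw); last by case: (tQ i).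
  by move=> b ->; case: (prime_ideal (pQ i)).
have d0 : distinct 0%N by exists (fun _ => all_of); split; case.
have [K dK nK] : exists2 K, distinct K & ~ distinct K.+1.
  apply: NNPP => hn; apply: bound; elim: M.+1 => // K IH.
  by apply: NNPP => h; apply: hn; exists K.
have [Q [tQ dQ]] := dK; exists K, Q; split=> // Q' tQ'.
apply: NNPP => hn; apply: nK.
exists (fun i => if unlift ord_max i is Some j then Q j else Q'); split.
  by move=> i; case: unliftP => [j|] _.
move=> i j; case: (unliftP ord_max i) => [i'|] ->; case: (unliftP ord_max j) => [j'|] ->.
- by move=> ij; apply: dQ; apply: contra_neq ij => ->.
- by move=> _ h; apply: hn; exists i'.
- by move=> _ h; apply: hn; exists j' => b; split=> /h.
- by rewrite eqxx.
Qed.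

End TopPrimes.

(** * Derivatives of a relation of least degree *)

Section FormalDerivatives.

Lemma mderivXU (R : comNzRingType) M (t t' : 'I_M) :
  ('X_t : {mpoly R[M]})^`M(t') = (t == t')%:R.
Proof.
rewrite mderivX mnm1E; case: eqP => [->|_]; last by rewrite scale0r.
have -> : (U_(t') - U_(t') = 0 :> 'X_{1.. M})%MM by apply/mnmP => i; rewrite mnmBE subnn mnm0E.
by rewrite scale1r mpolyX0.
Qed.

Lemma mpoly_closed_ind q (R : comNzRingType) (P : {mpoly R[q]} -> Prop) :
  (forall c, P c%:MP) -> (forall i, P 'X_i) ->
  (forall F G, P F -> P G -> P (F + G)) -> (forall F G, P F -> P G -> P (F * G)) ->
  forall F, P F.
Proof.
move=> hC hX hD hM; have P0 : P 0 by rewrite -mpolyC0.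
have P1 : P 1 by rewrite -mpolyC1.
elim/mpolyind => // c m F _ _ IH; apply: (hD) => //; rewrite -mul_mpolyC; apply: (hM) => //.
rewrite mpolyXE_id; apply: big_ind => // i _.
by elim: (m i) => [|r IHr]; rewrite ?expr0 // exprS; apply: (hM).
Qed.

Lemma mderiv_mmap (R D : comNzRingType) q M (f : {rmorphism R -> {mpoly D[M]}})
    (h : 'I_q -> {mpoly D[M]}) t F : (forall a, (f a)^`M(t) = 0) ->
  (mmap f h F)^`M(t) = \sum_v mmap f h F^`M(v) * (h v)^`M(t).
Proof.
move=> hf; elim/mpoly_closed_ind: F => [c|i|F G hF hG|F G hF hG].
- by rewrite mmapC hf big1 // => v _; rewrite mderivC rmorph0 mul0r.
- rewrite mmap_XU ?rmorph1 // (bigD1 i) //= mderivXU eqxx rmorph1 mul1r big1 ?addr0 //.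
  by move=> v /negPf vi; rewrite mderivXU eq_sym vi rmorph0 mul0r.
- rewrite rmorphD mderivD hF hG -big_split; apply: eq_bigr => v _.
  by rewrite mderivD rmorphD mulrDl.
- rewrite rmorphM mderivM hF hG mulr_suml mulr_sumr -big_split; apply: eq_bigr => v _.
  by rewrite mderivM rmorphD !rmorphM mulrDl /= mulrAC mulrA.
Qed.

(** All exponents that occur vanish in k. A nonzero one forces characteristic p, and then p divides
    them all; perfectness supplies the roots of the coefficients. *)
Lemma mderiv_eq0_root (k : fieldType) q (F : {mpoly k[q]}) : perfect_field k ->
  (forall v, F^`M(v) = 0) ->
  F = (F@_0)%:MP \/ exists p G, prime.prime p /\ F = G ^+ p.
Proof.
move=> kperf dF.
have coef0 u v : u \in msupp F -> (u v)%:R = 0 :> k.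
  move=> uF; case uv: (u v) => [//|r]; rewrite -uv.
  have := congr1 (mcoeff (u - U_(v))) (dF v); rewrite mcoeff_deriv mcoeff0.
  rewrite submK; last by rewrite lep1mP uv.
  rewrite mnmBE mnm1E eqxx uv subn1 /= => /eqP; rewrite -[F@_u *+ _]mulr_natr mulf_eq0.
  by rewrite mcoeff_msupp in uF; rewrite (negPf uF) => /eqP.
have [[u [uF u0]]|hn] := classic (exists u, u \in msupp F /\ u <> 0%MM); last first.
  left; apply/msize1_polyC; rewrite msizeE; apply/bigmax_leqP_seq => u uF _.
  have -> : u = 0%MM by apply: NNPP => h; apply: hn; exists u.
  by rewrite mdeg0.
have [v uv] : exists v, (0 < u v)%N.
  apply: NNPP => h; apply: u0; apply/mnmP => v; rewrite mnm0E; apply/eqP.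
  by rewrite -leqn0 leqNgt; apply/negP => uv; apply: h; exists v.
right; have [p hp] := natf0_pchar uv (introT eqP (coef0 u v uF)).
have [r hr] := boolp.choice (kperf p hp).
have hp' : p \in [pchar {mpoly k[q]}].
  have [pp p0] := andP hp; rewrite inE pp -mpolyC_nat.
  by move: p0 => /eqP ->; rewrite mpolyC0 eqxx.
exists p, (\sum_(w <- msupp F) r F@_w *: 'X_[[multinom (w i %/ p)%N | i < q]]).
split; first by case/andP: hp.
rewrite -(pFrobenius_autE hp') rmorph_sum [LHS]mpolyE big_seq [RHS]big_seq.
apply: eq_bigr => w wF; rewrite /= pFrobenius_autE exprZn hr mpolyXn.
congr (_ *: 'X_[_]); apply/mnmP => i; rewrite mulmnE mnmE divnK //.
by rewrite (dvdn_pcharf hp) coef0.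
Qed.

Lemma msize_root (k : fieldType) q (G : {mpoly k[q]}) p : (1 < msize G)%N ->
  (1 < p)%N -> (msize G < msize (G ^+ p))%N.
Proof.
move=> sG; have G0 : G != 0 by rewrite -msize_poly_eq0; case: (msize G) sG.
have step r : (msize G <= msize (G ^+ r.+1))%N.
  elim: r => [|r IH]; first by rewrite expr1.
  rewrite exprS msizeM ?expf_neq0 //.
  move: sG IH; case: (msize G) => // a _; case: (msize _) => // b _.
  by rewrite addSn addnS leq_addr.
case: p => [|[|p]] // _; rewrite exprS msizeM ?expf_neq0 //.
move: sG (step p); case: (msize G) => [|[|a]] // _; case: (msize _) => [|[|b]] // _.
by rewrite addSn addSn !addnS ltnS !ltnS leq_addr.
Qed.

End FormalDerivatives.

Section GenericMatrix.
Variables (k : fieldType) (n : nat) (B : comAlgType k) (y : 'I_n -> B).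

Lemma mxvec_index_eq e (i i' : 'I_e) (j j' : 'I_n) :
  (mxvec_index i j == mxvec_index i' j') = (i == i') && (j == j').
Proof.
by rewrite (inj_eq (@cast_ord_inj _ _ _)) (inj_eq enum_rank_inj) xpair_eqE.
Qed.

(** A selection of m of the e generic rows, so that relations among few forms live in the ring with
    all the coefficients. *)
Definition genmx (R : comNzRingType) e m (iota : 'I_m -> 'I_e) :
    'M[{mpoly R[(e * n)%N]}]_(m, n) := \matrix_(i, j) 'X_(mxvec_index (iota i) j).

Section Derivative.
Variables (R : comNzRingType) (eps : {rmorphism B -> R}) (e m : nat) (iota : 'I_m -> 'I_e).
Hypothesis iota_inj : injective iota.

Definition gphi : {mpoly k[(m * n + m)%N]} -> {mpoly R[(e * n)%N]} :=
  phi y (@mpolyC (e * n) R \o eps) (genmx R iota).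
HB.instance Definition _ := GRing.RMorphism.on gphi.

Lemma gphiC c : gphi c%:MP = (eps c%:A)%:MP.
Proof. by rewrite /gphi /phi mmapC. Qed.

Lemma gphi_c i j : gphi 'X_(cvar i j) = 'X_(mxvec_index (iota i) j).
Proof. by rewrite /gphi /phi mmap_XU ?rmorph1 // vmap_c mxE. Qed.

Lemma gphi_z i : gphi 'X_(zvar n i) = \sum_j 'X_(mxvec_index (iota i) j) * (eps (y j))%:MP.
Proof.
rewrite /gphi /phi mmap_XU ?rmorph1 // vmap_z; apply: eq_bigr => j _.
by rewrite mxE.
Qed.

(** Chain rule: c_ij occurs both as a variable and inside the form substituted for Z_i. *)
Lemma gphi_deriv F i j :
  (gphi F)^`M(mxvec_index (iota i) j) =
  gphi F^`M(cvar i j) + gphi F^`M(zvar n i) * (eps (y j))%:MP.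
Proof.
rewrite [gphi]/gphi /phi mderiv_mmap => [|a]; last by rewrite /= mderivC.
set h := mmap _ _; rewrite big_split_ord /=; congr (_ + _).
  rewrite (bigD1 (mxvec_index i j)) //= -/(cvar i j) vmap_c mxE mderivXU eqxx mulr1.
  rewrite big1 ?addr0 // => t; case/mxvec_indexP: t => i' j'; rewrite -/(cvar i' j').
  rewrite vmap_c mxE mderivXU !mxvec_index_eq (inj_eq iota_inj) => /negPf ->.
  exact: mulr0.
have dz i' : (zform y (mpolyC (e * n) (R:=R) \o eps) (genmx R iota) i')^`M(mxvec_index (iota i) j)
    = (i' == i)%:R * (eps (y j))%:MP.
  rewrite /zform raddf_sum /= (bigD1 j) //= mxE mderivM mderivXU mderivC mulr0 addr0.
  rewrite mxvec_index_eq eqxx andbT (inj_eq iota_inj) big1 ?addr0 // => j' /negPf jj.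
  by rewrite mxE mderivM mderivXU mderivC mulr0 addr0 mxvec_index_eq jj andbF mul0r.
rewrite (bigD1 i) //= -/(zvar n i) vmap_z dz eqxx mul1r big1 ?addr0 //.
by move=> i' /negPf ii; rewrite -/(zvar n i') vmap_z dz ii mul0r mulr0.
Qed.

Lemma gphi_deriv0 F r j : (forall i, iota i != r) -> (gphi F)^`M(mxvec_index r j) = 0.
Proof.
move=> nr; rewrite [gphi]/gphi /phi mderiv_mmap => [|a]; last by rewrite /= mderivC.
have dX i j' : ('X_(mxvec_index (iota i) j') : {mpoly R[(e * n)%N]})^`M(mxvec_index r j) = 0.
  by rewrite mderivXU mxvec_index_eq (negPf (nr i)).
rewrite big1 // => v _; elim/var_ind: v => [i j'|i].
  by rewrite vmap_c mxE dX mulr0.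
rewrite vmap_z; suff -> : (zform y (mpolyC (e * n) (R:=R) \o eps) (genmx R iota) i)
    ^`M(mxvec_index r j) = 0 by rewrite mulr0.
rewrite /zform raddf_sum big1 // => j' _.
by rewrite mxE /= mderivM dX mderivC mulr0 mul0r addr0.
Qed.

End Derivative.

(** Degree is total degree in c and Z together: every partial derivative of a relation is then
    strictly smaller, and so is its p-th root, which is again a relation because D is a domain. *)
Lemma separable_relation (D : idomainType) (pi : {rmorphism B -> D}) e m
    (iota : 'I_m -> 'I_e) F : injective iota -> perfect_field k -> F != 0 ->
  gphi pi iota F = 0 ->
  exists H i, gphi pi iota H = 0 /\ gphi pi iota H^`M(zvar n i) != 0.
Proof.
move=> iinj kperf.
have nconst (G : {mpoly k[(m * n + m)%N]}) : G != 0 -> gphi pi iota G = 0 -> (1 < msize G)%N.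
  move=> G0 hG; rewrite ltnNge; apply/negP => /msize1_polyC eG.
  move: hG; rewrite eG gphiC => /eqP; rewrite mpolyC_eq0 => /eqP e0.
  have c0 : G@_0 != 0 by apply: contraNneq G0 => h; rewrite eG h.
  have e1 : (G@_0)%:A * (G@_0)^-1%:A = 1 :> B by rewrite mulr_algl scalerA mulfV // scale1r.
  by have := rmorph1 pi; rewrite -e1 rmorphM e0 mul0r => /esym /eqP; rewrite oner_eq0.
move sF: (msize F) => N; elim/ltn_ind: N F sF => N IH F sF F0 hF.
have small G : (msize G < N)%N -> gphi pi iota G = 0 ->
    (exists H i, gphi pi iota H = 0 /\ gphi pi iota H^`M(zvar n i) != 0) \/ G = 0.
  move=> sG hG; have [->|G0] := eqVneq G 0; first by right.
  by left; apply: (IH _ sG G).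
have sd v : (msize F^`M(v) < N)%N.
  rewrite -sF; have := nconst _ F0 hF; rewrite msizeE => sF1.
  apply: (@leq_ltn_trans (msize F).-1); last by rewrite -msizeE in sF1; rewrite ltn_predL ltnW.
  rewrite msizeE; apply/bigmax_leqP_seq => u; rewrite mcoeff_msupp mcoeff_deriv => hu _.
  have : (u + U_(v))%MM \in msupp F.
    by rewrite mcoeff_msupp; apply: contraNneq hu => ->; rewrite mul0rn.
  move/msize_mdeg_lt; rewrite mdegD mdeg1 addn1.
  by case: (msize F).
apply: NNPP => hn; have noex G : (msize G < N)%N -> gphi pi iota G = 0 -> G = 0.
  by move=> sG /(small _ sG) [].
have dz i : F^`M(zvar n i) = 0.
  apply: noex => //; apply/eqP/negPn/negP => h; apply: hn.
  by exists F, i.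
have dF v : F^`M(v) = 0.
  elim/var_ind: v => // i j; apply: noex => //.
  have := gphi_deriv pi iinj F i j; rewrite dz hF mderiv0 rmorph0 mul0r addr0.
  by move=> <-.
have [eF|[p [G [pp eF]]]] := mderiv_eq0_root kperf dF.
  by have := nconst _ F0 hF; rewrite eF msizeC; case: (_ != 0).
have G0 : G != 0 by apply: contraNneq F0 => h; rewrite eF h expr0n; case: (p) pp.
have hG : gphi pi iota G = 0.
  by move: hF; rewrite eF rmorphXn => /eqP; rewrite expf_eq0 => /andP [_ /eqP].
have sG : (msize G < N)%N.
  by rewrite -sF eF; apply: msize_root; [apply: nconst|apply: prime_gt1].
by move: G0; rewrite (noex _ sG hG) eqxx.
Qed.

End GenericMatrix.

(** * The generic algebra at a prime *)

Section IdealGenerated.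
Variable R : comNzRingType.

Inductive ideal_gen (G : R -> Prop) : R -> Prop :=
  | ig_0 : ideal_gen G 0
  | ig_in a x : G x -> ideal_gen G (a * x)
  | ig_D x z : ideal_gen G x -> ideal_gen G z -> ideal_gen G (x + z).

Lemma ideal_gen_ideal G : ideal_pred (ideal_gen G).
Proof.
split; [exact: ig_0|exact: ig_D|move=> a x; elim=> [|c z Gz|z t _ hz _ ht]].
- by rewrite mulr0; exact: ig_0.
- by rewrite mulrA; exact: ig_in.
- by rewrite mulrDr; apply: ig_D.
Qed.

Lemma ideal_gen_in (G : R -> Prop) x : G x -> ideal_gen G x.
Proof. by move=> Gx; rewrite -[x]mul1r; apply: ig_in. Qed.

Lemma ideal_gen_least (G I : R -> Prop) : ideal_pred I -> (forall x, G x -> I x) ->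
  forall x, ideal_gen G x -> I x.
Proof.
move=> [I0 ID IM] GI x; elim=> [//|a z /GI Iz|z t _ hz _ ht]; first exact: IM.
exact: ID.
Qed.

End IdealGenerated.

Section GenericLocal.
Variables (k : fieldType) (n : nat) (B : comAlgType k) (y : 'I_n -> B) (d s' : nat).
Let s := s'.+1.
Let e := (d + s)%N.
Let Bc := {mpoly B[(e * n)%N]}.

Definition coefs_in (Q : B -> Prop) (w : Bc) := forall m, Q w@_m.

(** The algebra k[c][z_1, ..., z_e] inside B[c], of which the subalgebra A is a specialization. *)
Definition genA (w : Bc) := exists G, w = gphi y idfun (@id 'I_e) G.

Lemma genA_subring : subring_pred genA.
Proof.
split.
- by exists 1; rewrite rmorph1.
- by exists (-1); rewrite rmorphN1.
- by move=> _ _ [F ->] [G ->]; exists (F + G); rewrite rmorphD.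
- by move=> _ _ [F ->] [G ->]; exists (F * G); rewrite rmorphM.
Qed.

Lemma genA_const (c : k) : genA (c%:A%:MP).
Proof. by exists c%:MP; rewrite gphiC. Qed.

Lemma genA_var i j : genA 'X_(mxvec_index i j).
Proof. by exists 'X_(cvar i j); rewrite gphi_c. Qed.

Lemma genA_z i : genA (\sum_j 'X_(mxvec_index i j) * (y j)%:MP).
Proof. by exists 'X_(zvar n i); rewrite gphi_z. Qed.

Lemma genA_gphi m (iota : 'I_m -> 'I_e) F : genA (gphi y idfun iota F).
Proof.
have [_ _ AD AM] := genA_subring.
elim/mpoly_closed_ind: F => [c|v|F G hF hG|F G hF hG].
- by rewrite gphiC; apply: genA_const.
- elim/var_ind: v => [i j|i]; first by rewrite gphi_c; apply: genA_var.
  by rewrite gphi_z; apply: genA_z.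
- by rewrite rmorphD; apply: AD.
- by rewrite rmorphM; apply: AM.
Qed.

(** Generators of the ideal of B[c] spanned by the contraction of Q[c] to the generic algebra and by
    the square of Q[c]. *)
Definition gen_sq (Q : B -> Prop) (w : Bc) :=
  (coefs_in Q w /\ genA w) \/
  exists q1 q2, [/\ coefs_in Q q1, coefs_in Q q2 & w = q1 * q2].

Lemma coefs_in_deriv Q w t : ideal_pred Q -> coefs_in Q w -> coefs_in Q w^`M(t).
Proof.
move=> hQ hw m; rewrite mcoeff_deriv -mulr_natl.
by case: hQ => _ _; apply; apply: hw.
Qed.

Section AtPrime.
Variables (Q : B -> Prop) (pQ : prime Q).
Variables (D : idomainType) (pi : {rmorphism B -> D}).
Hypothesis piP : forall b, pi b = 0 <-> Q b.
Hypothesis pi_surj : forall t, exists b, pi b = t.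

Lemma coefs_inP w : coefs_in Q w <-> map_mpoly pi w = 0.
Proof.
split=> [h|h m].
  by apply/mpolyP => m; rewrite mcoeff_map_mpoly mcoeff0; apply/piP.
by apply/piP; rewrite -mcoeff_map_mpoly h mcoeff0.
Qed.

Lemma coefs_in_ideal : ideal_pred (coefs_in Q).
Proof.
split.
- by apply/coefs_inP; rewrite rmorph0.
- by move=> x z /coefs_inP hx /coefs_inP hz; apply/coefs_inP; rewrite rmorphD /= hx hz addr0.
- by move=> a x /coefs_inP hx; apply/coefs_inP; rewrite rmorphM /= hx mulr0.
Qed.

Lemma coefs_in_prime a b : coefs_in Q (a * b) -> coefs_in Q a \/ coefs_in Q b.
Proof.
by rewrite !coefs_inP rmorphM => /eqP; rewrite mulf_eq0 => /orP [] /eqP; [left|right].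
Qed.

Lemma notin_coefsM a b : ~ coefs_in Q a -> ~ coefs_in Q b -> ~ coefs_in Q (a * b).
Proof. by move=> ha hb /coefs_in_prime []. Qed.

Lemma notin_coefsX a N : ~ coefs_in Q a -> ~ coefs_in Q (a ^+ N).
Proof.
by rewrite !coefs_inP rmorphXn => /eqP ha /eqP; rewrite expf_eq0 (negPf ha) andbF.
Qed.

Lemma coefs_in_const b : coefs_in Q b%:MP <-> Q b.
Proof.
rewrite coefs_inP map_mpolyC -piP.
by split=> /eqP; rewrite ?mpolyC_eq0 => /eqP // h; apply/eqP; rewrite mpolyC_eq0; apply/eqP.
Qed.

Lemma map_mpoly_surj (t : {mpoly D[(e * n)%N]}) : exists w : Bc, map_mpoly pi w = t.
Proof.
elim/mpoly_closed_ind: t => [c|i|_ _ [F <-] [G <-]|_ _ [F <-] [G <-]].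
- by have [b <-] := pi_surj c; exists b%:MP; rewrite map_mpolyC.
- by exists 'X_i; rewrite map_mpolyX.
- by exists (F + G); rewrite rmorphD.
- by exists (F * G); rewrite rmorphM.
Qed.

Lemma gphi_map m (iota : 'I_m -> 'I_e) F :
  map_mpoly pi (gphi y idfun iota F) = gphi y pi iota F.
Proof.
elim/mpoly_closed_ind: F => [c|v|F G hF hG|F G hF hG].
- by rewrite !gphiC map_mpolyC.
- elim/var_ind: v => [i j|i]; first by rewrite !gphi_c map_mpolyX.
  rewrite !gphi_z rmorph_sum; apply: eq_bigr => j _.
  by rewrite rmorphM /= map_mpolyX map_mpolyC.
- by rewrite !rmorphD /= hF hG.
- by rewrite !rmorphM /= hF hG.
Qed.

Let Q2 := ideal_gen (fun w : Bc => exists q1 q2, [/\ coefs_in Q q1, coefs_in Q q2 & w = q1 * q2]).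
Let NN := ideal_gen (gen_sq Q).

(** Q[c] is extended from B, so derivatives by c preserve it; by the product rule they preserve its
    square. *)
Lemma square_deriv w t : Q2 w -> Q2 w^`M(t).
Proof.
have hQ2 : ideal_pred Q2 by exact: ideal_gen_ideal.
have [Q20 Q2D Q2M] := hQ2.
elim=> [|a _ [q1 [q2 [h1 h2 ->]]]|x z _ hx _ hz].
- by rewrite mderiv0.
- rewrite mderivM mderivM mulrDr.
  have dq q : coefs_in Q q -> coefs_in Q q^`M(t).
    by move=> hq; apply: coefs_in_deriv => //; apply: prime_ideal.
  have in2 p q : coefs_in Q p -> coefs_in Q q -> Q2 (p * q).
    by move=> hp hq; apply: ideal_gen_in; exists p, q.
  by apply: (Q2D); [|apply: (Q2D)]; apply: (Q2M); apply: in2 => //; apply: dq.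
- by rewrite mderivD; apply: Q2D.
Qed.

Lemma Q2_NN w : Q2 w -> NN w.
Proof.
apply: ideal_gen_least; first exact: ideal_gen_ideal.
by move=> x hx; apply: ideal_gen_in; right.
Qed.

Section Generators.
Variable b : 'I_s -> B.
Hypothesis Qb : forall t, Q (b t).
Hypothesis genb : forall x, Q x -> exists u, ~ Q u /\
  exists r : 'I_s -> B, u * x = \sum_t r t * b t.

Lemma coefs_in_gen w : coefs_in Q w -> exists u, ~ Q u /\
  exists r : 'I_s -> Bc, u%:MP * w = \sum_t r t * (b t)%:MP.
Proof.
move=> hw; rewrite [w]mpolyE.
pose T (z : Bc) := exists u, ~ Q u /\
  exists r : 'I_s -> Bc, u%:MP * z = \sum_t r t * (b t)%:MP.
rewrite -/(T _); apply: big_ind => [|x z [u [nu [r hr]]] [v [nv [q hq]]]|m _].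
- exists 1; split; first exact: prime_proper.
  by exists (fun _ => 0); rewrite mulr0 big1 // => t _; rewrite mul0r.
- exists (u * v); split; first exact: primeMn.
  exists (fun t => v%:MP * r t + u%:MP * q t).
  rewrite (eq_bigr (fun t => v%:MP * (r t * (b t)%:MP) + u%:MP * (q t * (b t)%:MP))).
    by rewrite big_split -!mulr_sumr -hr -hq mpolyCM /=; ring.
  by move=> t _; rewrite mulrDl !mulrA.
- have [u [nu [r hr]]] := genb (hw m); exists u; split=> //.
  exists (fun t => (r t)%:MP * 'X_[m]).
  rewrite -mul_mpolyC mulrA -mpolyCM hr rmorph_sum /= mulr_suml; apply: eq_bigr => t _.
  by rewrite mpolyCM mulrAC.
Qed.

(* Either the [eta l] generate Q modulo squares, or they are dependent there, and
   differentiating a dependence relation by the row of coefficients on which only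
   one [eta l] depends puts a multiple of [omega] into the ideal. *)
Lemma generic_rows (eta : 'I_s -> Bc) (omega : 'I_n -> Bc) (row : 'I_s -> 'I_e) :
  (forall l, coefs_in Q (eta l)) -> (forall l, genA (eta l)) ->
  (forall l l' j, l != 0 -> (eta l')^`M(mxvec_index (row l) j) = (l == l')%:R * omega j) ->
  (forall j, (eta 0)^`M(mxvec_index (row 0) j) = omega j) ->
  (exists h, ~ coefs_in Q h /\ forall j, NN (h * omega j)) \/
  (forall x, Q x -> exists w, ~ coefs_in Q w /\ NN (w * x%:MP)).
Proof.
move=> Qeta Aeta deta deta0.
have hNN : ideal_pred NN by exact: ideal_gen_ideal.
have hQ2 : ideal_pred Q2 by exact: ideal_gen_ideal.
have [_ NND NNM] := hNN.
have NNeta l : NN (eta l) by apply: ideal_gen_in; left.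
have /fin_all_exists [u hu] := fun l => coefs_in_gen (Qeta l).
have /fin_all_exists [beta hbeta] : forall l, exists r : 'I_s -> Bc,
    (u l)%:MP * eta l = \sum_t r t * (b t)%:MP by move=> l; case: (hu l).
have nu l : ~ Q (u l) by case: (hu l).
pose M := \matrix_(l, t) beta l t.
(* If det M is outside Q[c], Cramer expresses det M times each b_t through the eta_l, up to the
   factors u_l. *)
have [d0|dn] := classic (coefs_in Q (\det M)); last first.
  right=> x /genb [v [nv [r hr]]]; exists (\det M * v%:MP).
  split; first by apply: notin_coefsM => // /coefs_in_const.
  rewrite -mulrA -mpolyCM hr rmorph_sum mulr_sumr; apply: ideal_sum => // t _.
  rewrite /= mpolyCM mulrCA; apply: (NNM).
  apply: (det_mul_ideal hNN (u := fun t => (b t)%:MP)) => l.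
  rewrite (eq_bigr (fun t => beta l t * (b t)%:MP)) => [|t' _]; last by rewrite mxE.
  by rewrite -hbeta; apply: (NNM).
(* A kernel vector of M over (B/Q)[c], lifted to B[c], is a dependence of the eta_l modulo the
   square. *)
left; move/coefs_inP: d0 => /eqP; rewrite -det_map_mx => /det0P [v v0 vM].
have /fin_all_exists [g hg] := fun l => map_mpoly_surj (v 0 l).
pose h l := g l * (u l)%:MP.
have rel : Q2 (\sum_l h l * eta l).
  rewrite (eq_bigr (fun l => \sum_t g l * beta l t * (b t)%:MP)); last first.
    by move=> l _; rewrite /h -mulrA hbeta mulr_sumr; apply: eq_bigr => t _; rewrite mulrA.
  rewrite exchange_big; apply: ideal_sum => // t _; rewrite -mulr_suml.
  apply: ideal_gen_in; do 2![eexists]; split; last by [].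
    apply/coefs_inP; move/rowP/(_ t): vM; rewrite !mxE => vM; rewrite rmorph_sum -[RHS]vM.
    by apply: eq_bigr => l _; rewrite rmorphM /= hg !mxE.
  exact/coefs_in_const.
have [l0 nl0] : exists l, ~ coefs_in Q (h l).
  apply: NNPP => hn; case/negP: v0; apply/eqP/rowP => l; rewrite mxE -hg.
  apply/coefs_inP; apply: NNPP => nl; apply: hn; exists l.
  by apply: notin_coefsM => // /coefs_in_const /nu.
have drel (r : 'I_s) (I : pred 'I_s) j : Q2 (\sum_(l | I l) h l * eta l) ->
    (forall l, I l -> (eta l)^`M(mxvec_index (row r) j) = (r == l)%:R * omega j) ->
    I r -> NN (h r * omega j).
  move=> hI dI Ir; have := Q2_NN (square_deriv (mxvec_index (row r) j) hI).
  rewrite raddf_sum /=.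
  rewrite (eq_bigr (fun l => (h l)^`M(mxvec_index (row r) j) * eta l +
      h l * ((r == l)%:R * omega j))).
    rewrite big_split /= [X in _ + X](bigD1 r) //= eqxx mul1r [X in _ + (_ + X)]big1 ?addr0.
      move=> hN; rewrite -(addKr (\sum_(l | I l) (h l)^`M(mxvec_index (row r) j) * eta l)
        (h r * omega j)).
      apply: (NND) => //; apply: idealN => //.
      by apply: ideal_sum => // l _; apply: (NNM).
    by move=> l /andP [_ /negPf lr]; rewrite eq_sym lr mul0r mulr0.
  by move=> l Il; rewrite mderivM dI.
have [[l [ln0 nl]]|hn] := classic (exists l, l != 0 /\ ~ coefs_in Q (h l)).
  exists (h l); split=> // j; apply: (drel l predT) => // l' _; exact: deta.
(* Only h_0 is outside Q[c]. The other terms lie in the square already and must be discarded first,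
   as the other eta_l may involve row 0 too. *)
have l00 : l0 = 0 by apply: NNPP => /eqP l00; apply: hn; exists l0.
exists (h 0); split=> [|j]; first by rewrite -l00.
apply: (drel 0 (pred1 0)) => [|l /eqP ->|//]; last by rewrite eqxx mul1r.
rewrite big_pred1_eq.
move: rel; rewrite (bigD1 0) //= => rel.
apply: (ideal_congr_mem hQ2 _ rel); rewrite opprD addrA subrr add0r.
apply: idealN => //; apply: ideal_sum => // l ln0; apply: ideal_gen_in.
exists (h l), (eta l); split=> //.
by apply: NNPP => nl; apply: hn; exists l.
Qed.

End Generators.
End AtPrime.
End GenericLocal.

Section GenericLocalData.
Variables (k : fieldType) (n : nat) (B : comAlgType k) (y : 'I_n -> B) (d s' : nat).
Let s := s'.+1.
Let e := (d + s)%N.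
Let Bc := {mpoly B[(e * n)%N]}.
Hypothesis kperf : perfect_field k.
Hypothesis geny : generates y.
Variable F : {mpoly k[(d.+1 * n + d.+1)%N]}.
Hypothesis F0 : F != 0.
Hypothesis relF : forall (B' : comNzRingType) (eps : {rmorphism B -> B'})
  (C : 'M[B']_(d.+1, n)), phi y eps C F = 0.

Lemma rows_le : (d.+1 <= e)%N. Proof. by rewrite /e /s addnS ltnS leq_addr. Qed.
Let iota := widen_ord rows_le.

Let iota_inj : injective iota.
Proof. by move=> i j /(congr1 val) /= h; apply: val_inj. Qed.

(** The row d, which is [rshift d 0], already belongs to H; only l != 0 names a row absent from
    H. *)
Let iota_row i (l : 'I_s) : l != 0 -> iota i != rshift d l.
Proof.
move=> l0; apply/negP => /eqP /(congr1 val) /= h.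
have : (i < d + l)%N by apply: leq_trans (ltn_ord i) _; rewrite -[d.+1]addn1 leq_add2l lt0n.
by rewrite h ltnn.
Qed.

(** The clause on Q2 concerns any ideal, since it is later applied to the other primes of dimension
    d in order to separate them from Q. *)
Lemma generic_local (Q : B -> Prop) : prime Q ->
  exists (eta0 D0 : Bc) (omega : 'I_n -> Bc),
  [/\ genA y eta0 /\ genA y D0,
      coefs_in Q eta0 /\ ~ coefs_in Q D0,
      forall b : B, exists N a (r : 'I_n -> Bc),
        genA y a /\ D0 ^+ N * b%:MP = a + \sum_j r j * omega j,
      forall Q2, ideal_pred Q2 -> coefs_in Q2 eta0 -> forall j, coefs_in Q2 (omega j)
    & edim_loc_le Q s -> forall b, Q b ->
        exists w : Bc, ~ coefs_in Q w /\ ideal_gen (gen_sq (d := d) (s' := s') y Q) (w * b%:MP)].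
Proof.
move=> pQ; have [D [pi [piP pi_surj]]] := prime_quotient pQ.
have relD : gphi y pi iota F = 0 by apply: relF.
have [H [i0 [H0 HD]]] := separable_relation iota_inj kperf F0 relD.
pose eta0 : Bc := gphi y idfun iota H.
pose D0 : Bc := gphi y idfun iota H^`M(zvar n i0).
pose G0 j : Bc := gphi y idfun iota H^`M(cvar i0 j).
pose omega (j : 'I_n) : Bc := eta0^`M(mxvec_index (iota i0) j).
have omegaE j : omega j = G0 j + D0 * (y j)%:MP by exact: gphi_deriv.
have hA := genA_subring y d s'; have [A1 AN1 AD AM] := hA.
have Aeta0 : genA y eta0 by apply: genA_gphi.
have AD0 : genA y D0 by apply: genA_gphi.
have AG0 j : genA y (G0 j) by apply: genA_gphi.
have Qeta0 : coefs_in Q eta0 by apply/(coefs_inP piP); rewrite gphi_map.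
have nD0 : ~ coefs_in Q D0 by move/(coefs_inP piP); rewrite gphi_map; apply/eqP.
have deta0 (l : 'I_s) j : l != 0 -> eta0^`M(mxvec_index (rshift d l) j) = 0.
  by move=> l0; apply: gphi_deriv0 => i; exact: iota_row.
clearbody eta0 D0 G0.
have om_in Q2 : ideal_pred Q2 -> coefs_in Q2 eta0 -> forall j, coefs_in Q2 (omega j).
  by move=> hQ2 h j; apply: coefs_in_deriv.
(* Modulo the omega_j, D0 y_j equals - G0_j, so a power of D0 clears the denominators of any
   polynomial in y. *)
have expand b : exists N a (r : 'I_n -> Bc),
    genA y a /\ D0 ^+ N * b%:MP = a + \sum_j r j * omega j.
  elim: (geny b) => {b} [j|c|a b _ [N [a1 [r [ha hN]]]] _ [M [b1 [q [hb hM]]]]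
    |a b _ [N [a1 [r [ha hN]]]] _ [M [b1 [q [hb hM]]]]].
  - exists 1%N, (- G0 j), (fun i => (i == j)%:R); split.
      exact: (subringN hA (AG0 j)).
    rewrite expr1 (bigD1 j) //= eqxx mul1r big1 ?addr0 ?omegaE ?addKr //.
    by move=> i /negPf ->; rewrite mul0r.
  - exists 0%N, (c%:A%:MP), (fun _ => 0); split; first exact: genA_const.
    by rewrite mul1r big1 ?addr0 // => j _; rewrite mul0r.
  - exists (N + M)%N, (D0 ^+ M * a1 + D0 ^+ N * b1),
      (fun j => D0 ^+ M * r j + D0 ^+ N * q j); split.
      by apply: AD; apply: AM => //; apply: subringX.
    rewrite (eq_bigr (fun j => D0 ^+ M * (r j * omega j) + D0 ^+ N * (q j * omega j))).
      by rewrite big_split -!mulr_sumr /= addrACA -!mulrDr -hN -hM exprD mpolyCD; ring.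
    by move=> j _; rewrite mulrDl !mulrA.
  - exists (N + M)%N, (a1 * b1),
      (fun j => r j * (b1 + \sum_i q i * omega i) + a1 * q j); split; first exact: AM.
    rewrite (eq_bigr (fun j => r j * omega j * (b1 + \sum_i q i * omega i) + a1 * (q j * omega j))).
      rewrite big_split -mulr_suml -mulr_sumr /=.
      transitivity ((D0 ^+ N * a%:MP) * (D0 ^+ M * b%:MP)); first by rewrite exprD mpolyCM; ring.
      by rewrite hN hM; ring.
    by move=> j _; ring.
exists eta0, D0, omega; split=> // /(edim_loc_family pQ) [bt [Qbt genbt]] b Qb.
pose row (l : 'I_s) : 'I_e := if l == 0 then iota i0 else rshift d l.
pose eta (l : 'I_s) : Bc :=
  if l == 0 then eta0 else \sum_j 'X_(mxvec_index (rshift d l) j) * omega j.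
have Aeta l : genA y (eta l).
  rewrite /eta; case: ifP => // _.
  rewrite (eq_bigr (fun j => 'X_(mxvec_index (rshift d l) j) * G0 j +
     D0 * ('X_(mxvec_index (rshift d l) j) * (y j)%:MP))).
    rewrite big_split -mulr_sumr /=; apply: AD.
      by apply: subring_sum => [|j _]; [exact: hA|apply: AM => //; apply: genA_var].
    by apply: AM => //; apply: genA_z.
  by move=> j _; rewrite omegaE mulrDr mulrCA.
have Qeta l : coefs_in Q (eta l).
  rewrite /eta; case: ifP => // _; have hI := coefs_in_ideal n d s' piP.
  apply: ideal_sum => [|j _]; first exact: hI.
  by case: (hI) => _ _ IM; exact: (IM _ _ (om_in _ (prime_ideal pQ) Qeta0 j)).
have deta l l' j : l != 0 ->
    (eta l')^`M(mxvec_index (row l) j) = (l == l')%:R * omega j.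
  move=> l0; rewrite /row (negPf l0) /eta; case: (eqVneq l' 0) => [->|l'0].
    by rewrite (negPf l0) mul0r; apply: deta0.
  (* Derivatives commute and eta0 does not involve the row l, so neither does its derivative
     omega_i. *)
  have dom i : (omega i)^`M(mxvec_index (rshift d l) j) = 0.
    by rewrite /omega mderiv_comm deta0 ?mderiv0.
  rewrite raddf_sum (bigD1 j) //= mderivM dom mulr0 addr0 mderivXU mxvec_index_eq eqxx andbT.
  rewrite (inj_eq (@rshift_inj _ _)) [l' == l]eq_sym big1 ?addr0 //.
  move=> i /negPf ij; rewrite mderivM dom mulr0 addr0 mderivXU mxvec_index_eq ij andbF.
  exact: mul0r.
have [|//|[h [nh hom]]|hall] :=
  @generic_rows k n B y d s' Q pQ D pi piP pi_surj bt Qbt genbt eta omega row Qeta Aeta.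
- by move=> l l' j; apply: deta.
- have [N [a [r [Aa hN]]]] := expand b.
  have hI := coefs_in_ideal n d s' piP.
  exists (h * D0 ^+ N); split.
    apply: (notin_coefsM piP) => //; exact: (notin_coefsX piP).
  (* b and the omega_j lie in Q[c], so the part a of the expansion is in the contraction of Q[c],
     one of the generators. *)
  have Qa : coefs_in Q a.
    have h1 : coefs_in Q (a - D0 ^+ N * b%:MP).
      have h0 : coefs_in Q (\sum_j r j * omega j).
        apply: ideal_sum => [|j _]; first exact: hI.
        by case: (hI) => _ _ IM; exact: (IM _ _ (om_in _ (prime_ideal pQ) Qeta0 j)).
      by rewrite hN opprD addrA subrr add0r; apply: (idealN hI h0).
    have h2 : coefs_in Q (D0 ^+ N * b%:MP).
      by case: (hI) => _ _ IM; apply: IM; apply/(coefs_in_const _ _ _ piP).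
    exact: ideal_congr_mem hI h1 h2.
  have [_ ND NM] := ideal_gen_ideal (gen_sq (d := d) (s' := s') y Q).
  rewrite -mulrA hN mulrDr; apply: ND.
    by apply: NM; apply: ideal_gen_in; left.
  rewrite mulr_sumr; apply: ideal_sum => [|j _]; first exact: ideal_gen_ideal.
  by rewrite mulrCA; apply: NM.
- exact: hall.
Qed.

End GenericLocalData.

(** * The conductor *)

Section Conductor.
Variables (k : fieldType) (B : comAlgType k) (d : nat) (A : B -> Prop).
Hypothesis hA : subring_pred A.
Hypothesis intA : forall b, integral_mod A only_zero b.
Hypothesis dimB : ~ dim_ge (@all_of k B) only_zero d.+1.

(** The chain above Q, contracted to A, lifts to a chain above J. *)
Lemma top_lies_over Q J : top d Q -> prime J -> (forall x, A x -> (J x <-> Q x)) ->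
  top d J.
Proof.
move=> [pQ dQ] pJ JQ; split=> //.
have [P [pP sP P0]] := dim_ge_prime_chain pQ dQ.
have [||||Q' [pQ' sQ' _]] := @chain_lift k B A hA intA d (fun i x => A x /\ P i x) J.
- by move=> i il; apply: prime_contract => //; apply: pP.
- exact: chain_contract.
- exact: prime_ideal.
- by move=> x Ax Jx; rewrite P0; split=> //; apply/JQ.
- by exists Q'; split=> // i il; have [] := pQ' i il.
Qed.

Section AtPrime.
Variable Q : B -> Prop.
Hypothesis tQ : top d Q.
Let pQ : prime Q. Proof. by case: tQ. Qed.

Variables (m : nat) (D eta : B) (omega : 'I_m -> B).
Hypothesis AD : A D.
Hypothesis nD : ~ Q D.
Hypothesis Aeta : A eta.
Hypothesis Qeta : Q eta.
Hypothesis Qomega : forall j, Q (omega j).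
Hypothesis expand : forall b, exists N a (r : 'I_m -> B),
  A a /\ D ^+ N * b = a + \sum_j r j * omega j.
Hypothesis split_top : forall Q2, top d Q2 -> ~ Q2 eta \/ forall j, Q2 (omega j).

(** eta lies in A and Q, hence in Q2, which forces the omega_j into Q2. Then D^N b is congruent to
    the same element of A modulo both primes, and Q is contained in Q2. *)
Lemma top_over_unique Q2 : top d Q2 -> (forall x, A x -> (Q2 x <-> Q x)) ->
  forall b, Q2 b <-> Q b.
Proof.
move=> tQ2 Q2Q; have p2 : prime Q2 by case: tQ2.
have om2 j : Q2 (omega j).
  by case: (split_top tQ2) => // nh; case: nh; apply/Q2Q.
have nD2 : ~ Q2 D by move/(Q2Q _ AD).
have sub b : Q b -> Q2 b.
  move=> Qb; have [N [a [r [Aa e]]]] := expand b.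
  have Qom : forall Q', prime Q' -> (forall j, Q' (omega j)) ->
      Q' (D ^+ N * b - a).
    move=> Q' p' h; rewrite e addrC addKr; apply: ideal_sum; first exact: prime_ideal.
    by move=> j _; case: (prime_ideal p') => _ _; apply.
  have Qa : Q a.
    apply: (ideal_congr_mem (prime_ideal pQ) (idealBC (prime_ideal pQ) (Qom _ pQ Qomega))).
    by case: (prime_ideal pQ) => _ _; apply.
  have /(ideal_congr_mem (prime_ideal p2) (Qom _ p2 om2)) : Q2 a by apply/Q2Q.
  by case/(primeM p2) => // /(primeX p2).
by move=> b; split; [apply: (top_incomparable dimB tQ tQ2 sub)|apply: sub].
Qed.

(** Otherwise Bu contracts into Q, and going up gives a prime over the contraction of Q that
    contains u; it has dimension d, so it is Q. This lets multipliers outside Q be chosen in A. *)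
Lemma multiple_in_subring u : ~ Q u -> exists v, A (v * u) /\ ~ Q (v * u).
Proof.
move=> nu; apply: NNPP => hn.
pose I z := exists v, z = v * u.
have hI : ideal_pred I.
  split; first by exists 0; rewrite mul0r.
    by move=> _ _ [v ->] [w ->]; exists (v + w); rewrite mulrDl.
  by move=> a _ [v ->]; exists (a * v); rewrite mulrA.
have [|J [pJ IJ JQ]] := going_up hA intA (prime_contract hA pQ) hI.
  move=> x Ax [v ex]; split=> //; rewrite ex; apply: NNPP => nQ; apply: hn.
  by exists v; rewrite -ex; split=> //; rewrite ex.
have JQ' x : A x -> (J x <-> Q x).
  by move=> Ax; split=> [/(JQ _ Ax) []|Qx] //; apply/(JQ _ Ax).
apply: nu; apply/(top_over_unique (top_lies_over tQ pJ JQ') JQ').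
by apply: IJ; exists 1; rewrite mul1r.
Qed.

Let pB := ideal_gen (fun x => A x /\ Q x).

Section LocalGenerators.
Variables (s : nat) (b : 'I_s -> B).
Hypothesis genb : forall x, Q x -> exists u, ~ Q u /\
  exists r : 'I_s -> B, u * x = \sum_t r t * b t.
Hypothesis sqb : forall t, exists w, ~ Q w /\ ideal_gen (fun x =>
  (Q x /\ A x) \/ exists q1 q2, [/\ Q q1, Q q2 & x = q1 * q2]) (w * b t).

(* Nakayama: Q is generated by [A /\ Q] modulo Q^2, hence generated by it locally. *)
Lemma locally_extended x : Q x -> exists v, [/\ A v, ~ Q v & pB (v * x)].
Proof.
have iQ := prime_ideal pQ; have [Q0 QD QM] := iQ.
have ipB : ideal_pred pB by exact: ideal_gen_ideal.
have [pB0 pBD pBM] := ipB.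
(* One factor of each product in Q^2 is expanded in the b_t, the other becomes a coefficient in
   Q. *)
have lin z : ideal_gen (fun x => (Q x /\ A x) \/ exists q1 q2, [/\ Q q1, Q q2 & x = q1 * q2]) z ->
    exists u p (q : 'I_s -> B), [/\ ~ Q u, pB p, forall t, Q (q t) & u * z = p + \sum_t q t * b t].
  elim=> {z} [|a z [[Qz Az]|[q1 [q2 [Q1 Q2 ->]]]]|z1 z2 _ [u [p [q [nu hp hq e]]]]
      _ [u' [p' [q' [nu' hp' hq' e']]]]].
  - exists 1, 0, (fun _ => 0); split=> //; first exact: prime_proper.
    by rewrite mulr0 big1 ?addr0 // => t _; rewrite mul0r.
  - exists 1, (a * z), (fun _ => 0); split=> //; first exact: prime_proper.
      by apply: (pBM); apply: ideal_gen_in.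
    by rewrite mul1r big1 ?addr0 // => t _; rewrite mul0r.
  - have [u [nu [r hr]]] := genb Q2.
    exists u, 0, (fun t => a * q1 * r t); split=> //.
      by move=> t; apply: ideal_mulr => //; apply: (QM).
    rewrite add0r (eq_bigr (fun t => a * q1 * (r t * b t))); last by move=> t _; rewrite mulrA.
    by rewrite -mulr_sumr -hr; ring.
  - exists (u * u'), (u' * p + u * p'), (fun t => u' * q t + u * q' t); split.
    + exact: primeMn.
    + by apply: (pBD); apply: (pBM).
    + by move=> t; apply: (QD); apply: (QM).
    + rewrite (eq_bigr (fun t => u' * (q t * b t) + u * (q' t * b t))); last first.
        by move=> t _; rewrite mulrDl !mulrA.
      rewrite big_split -!mulr_sumr /= addrACA -!mulrDr -e -e'; ring.
have /fin_all_exists [mu hmu] : forall t, exists uq : B * B * ('I_s -> B),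
    [/\ ~ Q uq.1.1, pB uq.1.2, forall t', Q (uq.2 t') &
      uq.1.1 * b t = uq.1.2 + \sum_t' uq.2 t' * b t'].
  move=> t; have [w [nw /lin [u [p [q [nu hp hq e]]]]]] := sqb t.
  by exists (u * w, p, q); split=> //=; [apply: primeMn|rewrite -mulrA].
(* Modulo Q this matrix is diagonal with entries outside Q, so its determinant is outside Q. *)
pose M := \matrix_(i, j) ((mu i).1.1 *+ (i == j) - (mu i).2 j).
have hM t : pB (\det M * b t).
  apply: (det_mul_ideal ipB) => i.
  have [_ hp _ e] := hmu i.
  suff -> : \sum_j M i j * b j = (mu i).1.2 by [].
  rewrite (eq_bigr (fun j => (mu i).1.1 *+ (i == j) * b j - (mu i).2 j * b j)).
    rewrite sumrB (bigD1 i) //= eqxx mulr1n big1 ?addr0 ?e ?addrK // => j /negPf ji.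
    by rewrite eq_sym ji mulr0n mul0r.
  by move=> j _; rewrite mxE mulrBl.
have ndet : ~ Q (\det M).
  move=> Qdet; have := prime_prod (r := index_enum 'I_s) (p := predT)
    (F := fun i => (mu i).1.1) pQ; case=> [i _|]; first by case: (hmu i).
  have -> : \prod_i (mu i).1.1 = \det (diag_mx (\row_i (mu i).1.1)).
    by rewrite det_diag; apply: eq_bigr => i _; rewrite mxE.
  apply: (ideal_congr_mem iQ _ Qdet); apply: ideal_congr_det => // i j.
  rewrite !mxE; case: eqP => [->|_]; rewrite ?mulr1n ?mulr0n.
    by rewrite opprB addrC subrK; case: (hmu j).
  by rewrite !sub0r opprK; case: (hmu i).
move=> /genb [u [nu [r hr]]].
have [v [Av nv]] := multiple_in_subring (primeMn pQ nu ndet).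
exists (v * (u * \det M)); split=> //.
rewrite -mulrA [u * _]mulrC -mulrA hr !mulr_sumr; apply: ideal_sum => // t _.
by apply: (pBM); rewrite mulrCA; apply: (pBM).
Qed.

(** A second Nakayama argument, now over A: up to multipliers in A outside Q, each u_i is an element
    of A plus a combination of the u_j with coefficients in A and Q. The determinant of this system
    multiplies all of B into A. *)
Lemma conductor_notin q (u : 'I_q -> B) :
  (forall b, exists a : 'I_q -> B, (forall i, A (a i)) /\ b = \sum_i a i * u i) ->
  exists r, [/\ A r, ~ Q r & forall b, A (r * b)].
Proof.
move=> span; have iQ := prime_ideal pQ; have [Q0 QD QM] := iQ.
have [A1 AN1 AD' AM] := hA.
have ipB : ideal_pred pB by exact: ideal_gen_ideal.
have pBspan z : pB z -> exists P : 'I_q -> B,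
    (forall i, A (P i) /\ Q (P i)) /\ z = \sum_i P i * u i.
  elim=> {z} [|a z [Az Qz]|z1 z2 _ [P [hP ->]] _ [P' [hP' ->]]].
  - exists (fun _ => 0); split; first by move=> i; split=> //; apply: subring0.
    by rewrite big1 // => i _; rewrite mul0r.
  - have [c [hc ->]] := span a; exists (fun i => c i * z); split.
      by move=> i; split; [apply: (AM)|apply: (QM)].
    by rewrite mulr_suml; apply: eq_bigr => i _; rewrite mulrAC.
  - exists (fun i => P i + P' i); split.
      by move=> i; case: (hP i) => ? ?; case: (hP' i) => ? ?; split; [apply: AD'|apply: (QD)].
    by rewrite -big_split; apply: eq_bigr => i _; rewrite mulrDl.
have /fin_all_exists [ka hka] : forall i, exists ka : B * B * ('I_q -> B),
    [/\ A ka.1.1 /\ ~ Q ka.1.1, A ka.1.2, forall j, A (ka.2 j) /\ Q (ka.2 j) &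
      ka.1.1 * u i = ka.1.2 + \sum_j ka.2 j * u j].
  move=> i; have [N [a [r [Aa e]]]] := expand (u i).
  have Qom : Q (\sum_j r j * omega j) by apply: ideal_sum => // j _; apply: (QM).
  have [v [Av nv /pBspan [P [hP eP]]]] := locally_extended Qom.
  exists (v * D ^+ N, v * a, P); split=> //=.
  - split; first by apply: (AM) => //; apply: subringX.
    by apply: primeMn => // /(primeX pQ).
  - exact: AM.
  - by rewrite -mulrA e mulrDr eP.
pose M := \matrix_(i, j) ((ka i).1.1 *+ (i == j) - (ka i).2 j).
have AMij i j : A (M i j).
  rewrite mxE; apply: (AD'); last by apply: subringN => //; case: (hka i) => _ _ /(_ j) [].
  by case: eqP => _; rewrite ?mulr1n ?mulr0n; [case: (hka i) => -[]|apply: subring0].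
have Mu : M *m \col_i u i = \col_i (ka i).1.2.
  apply/colP => i; rewrite !mxE; have [_ _ _ e] := hka i.
  rewrite (eq_bigr (fun j => (ka i).1.1 *+ (i == j) * u j - (ka i).2 j * u j)).
    rewrite sumrB (bigD1 i) //= eqxx mulr1n big1 ?addr0 ?e ?addrK // => j /negPf ji.
    by rewrite eq_sym ji mulr0n mul0r.
  by move=> j _; rewrite !mxE mulrBl.
have Adet : A (\det M) by apply: subring_det.
have Au i : A (\det M * u i).
  have -> : \det M * u i = \sum_j \adj M i j * (ka j).1.2.
    transitivity (((\adj M *m M) *m (\col_i u i)) i 0).
      by rewrite mul_adj_mx mul_scalar_mx !mxE.
    by rewrite -mulmxA Mu mxE; apply: eq_bigr => j _; rewrite !mxE.
  apply: subring_sum => // j _; apply: (AM); last by case: (hka j).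
  rewrite mxE; apply: (AM); first exact: subringX.
  by apply: subring_det => // i' j'; rewrite 2!mxE.
exists (\det M); split=> //.
- move=> Qdet; have := prime_prod (r := index_enum 'I_q) (p := predT)
    (F := fun i => (ka i).1.1) pQ; case=> [i _|]; first by case: (hka i) => -[].
  have -> : \prod_i (ka i).1.1 = \det (diag_mx (\row_i (ka i).1.1)).
    by rewrite det_diag; apply: eq_bigr => i _; rewrite mxE.
  apply: (ideal_congr_mem iQ _ Qdet); apply: ideal_congr_det => // i j.
  rewrite !mxE; case: eqP => [->|_]; rewrite ?mulr1n ?mulr0n.
    by rewrite opprB addrC subrK; case: (hka j) => _ _ /(_ j) [].
  by rewrite !sub0r opprK; case: (hka i) => _ _ /(_ j) [].
- move=> z; have [a [ha ->]] := span z; rewrite mulr_sumr; apply: subring_sum => // i _.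
  by rewrite mulrCA; apply: (AM).
Qed.

End LocalGenerators.
End AtPrime.

(** A chain of length d above the annihilator lifts to B and starts at a prime of dimension d; the
    annihilator would lie in it, against r. *)
Lemma conductor_dim : (forall Q, top d Q -> exists r, [/\ A r, ~ Q r & forall b, A (r * b)]) ->
  quot_dim_lt A d.
Proof.
move=> h [P [pP sP]].
have [||||Q [pQ sQ QP]] := @chain_lift k B A hA intA d P only_zero.
- by move=> i il; case: (pP i il).
- by [].
- exact: ideal_only_zero.
- by move=> x Ax ->; case: (pP 0%N isT) => -[_ [P0 _]] _.
have tQ : top d (Q 0%N).
  split; first by case: (pQ 0%N isT).
  exists Q; split=> // i il; split; first by case: (pQ i il).
  exact: chain_sub sQ i il.
have [r [Ar nr hr]] := h _ tQ.
by apply: nr; apply/(QP 0%N isT _ Ar); case: (pP 0%N isT) => _; apply.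
Qed.

Lemma conductor_of_dim Q : quot_dim_lt A d -> top d Q -> exists a, ann_quot A a /\ ~ Q a.
Proof.
move=> hd [pQ dQ]; apply: NNPP => hn; apply: hd.
have [P [pP sP P0]] := dim_ge_prime_chain pQ dQ.
exists (fun i x => A x /\ P i x); split; last exact: chain_contract.
move=> i il; split; first by apply: prime_contract => //; apply: pP.
move=> x hx; split; first by case: hx.
apply: (chain_sub sP il); rewrite P0; apply: NNPP => nx; apply: hn.
by exists x.
Qed.

End Conductor.

(** * Local generators of a contracted prime under adjunction of an element *)

Section Adjunction.
Variables (k : fieldType) (B : comAlgType k) (Q : B -> Prop).
Hypothesis pQ : prime Q.
Implicit Types S : B -> Prop.

Definition adjoin S (z b : B) := exists p : {poly B}, (forall i, S p`_i) /\ b = p.[z].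

Lemma adjoin_subring S z : subring_pred S -> subring_pred (adjoin S z).
Proof.
move=> hS; have [S1 SN1 SD SM] := hS; have S0 := subring0 hS; split.
- by exists 1; split=> [i|]; rewrite ?hornerC // coef1; case: eqP.
- by exists (-1); split=> [i|]; rewrite ?hornerN ?hornerC // coefN coef1; case: eqP; rewrite ?oppr0.
- move=> _ _ [p [hp ->]] [q [hq ->]]; exists (p + q); rewrite hornerD; split=> // i.
  by rewrite coefD; apply: (SD).
- move=> _ _ [p [hp ->]] [q [hq ->]]; exists (p * q); rewrite hornerM; split=> // i.
  by rewrite coefM; apply: subring_sum => // j _; apply: (SM).
Qed.

Lemma adjoin_sub S z b : subring_pred S -> S b -> adjoin S z b.
Proof.
move=> hS Sb; exists b%:P; rewrite hornerC; split=> // i; rewrite coefC.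
by case: eqP => // _; apply: subring0.
Qed.

Lemma adjoin_in S z : subring_pred S -> adjoin S z z.
Proof.
move=> hS; exists 'X; rewrite hornerX; split=> // i; rewrite coefX.
by case: eqP => _; [case: hS|apply: subring0].
Qed.

(** The ideal is taken in B and after localization at Q, so the gs themselves need not lie in S. *)
Definition generated_at S (gs : seq B) := (forall g, g \in gs -> Q g) /\
  forall x, S x -> Q x -> exists u, ~ Q u /\ ideal_gen (fun g => g \in gs) (u * x).

(** Division by a least polynomial f of z modulo Q: one new generator f(z) suffices, and integrality
    guarantees that some f exists. *)
Lemma generated_adjoin S gs z : subring_pred S -> generated_at S gs ->
  integral_mod S Q z -> exists g, generated_at (adjoin S z) (g :: gs).
Proof.
move=> hS [Qgs hgs] [m [a [Sa Qa]]].
have [S1 SN1 SD SM] := hS; have S0 := subring0 hS.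
have iQ := prime_ideal pQ; have [Q0 QD QM] := iQ.
pose ok (p : {poly B}) := [/\ forall i, S p`_i, ~ Q (lead_coef p) & Q p.[z]].
have ok0 : ok ('X^m + \poly_(i < m) a i).
  split.
  - move=> i; rewrite coefD coefXn coef_poly; apply: (SD); first by case: eqP.
    by case: ifP.
  - rewrite lead_coefDl ?lead_coefXn; first exact: prime_proper.
    by rewrite size_polyXn ltnS size_poly.
  - rewrite hornerD hornerXn horner_poly.
    by rewrite (eq_bigr (fun i : 'I_m => a i * z ^+ i)).
have [f [okf minf]] : exists f, ok f /\ forall p, ok p -> (size f <= size p)%N.
  suff minimal N (p0 : {poly B}) : size p0 = N -> ok p0 ->
      exists f, ok f /\ forall p, ok p -> (size f <= size p)%N.
    exact: minimal erefl ok0.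
  elim/ltn_ind: N p0 => N IH p0 sp okp.
  have [[p [okp' lt]]|hn] := classic (exists p, ok p /\ (size p < N)%N).
    exact: (IH _ lt p).
  exists p0; split=> // p okp'; rewrite sp leqNgt; apply/negP => lt; apply: hn.
  by exists p.
have [Sf nf Qf] := okf.
exists f.[z]; split.
  by move=> g; rewrite inE => /orP [/eqP ->|/Qgs].
pose I := ideal_gen (fun g => g \in f.[z] :: gs).
have hI : ideal_pred I by exact: ideal_gen_ideal.
have [I0 ID IM] := hI.
have gsI x : ideal_gen (fun g => g \in gs) x -> I x.
  apply: ideal_gen_least => // g hg; apply: ideal_gen_in.
  by rewrite inE hg orbT.
move=> _ [h [Sh ->]]; move sh: (size h) => N; elim/ltn_ind: N h sh Sh => N IH h sh Sh Qh.
have [h0|h0] := eqVneq h 0.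
  by exists 1; rewrite h0 horner0 mulr0; split=> //; apply: prime_proper.
have N0 : (0 < N)%N by rewrite -sh size_poly_gt0.
have ltN (h' : {poly B}) : (forall j, (N <= j.+1)%N -> h'`_j = 0) -> (size h' < N)%N.
  move=> hj; rewrite -(prednK N0) ltnS; apply/leq_sizeP => j; rewrite -ltnS prednK //.
  exact: hj.
(* A leading coefficient in S and Q is locally generated by gs, so the leading term can be
   removed. *)
have [Ql|nl] := classic (Q (lead_coef h)).
  have [u1 [nu1 h1]] := hgs _ (Sh _ : S (lead_coef h)) Ql.
  pose h' := h - lead_coef h *: 'X^((size h).-1).
  have eh : h.[z] = h'.[z] + lead_coef h * z ^+ (size h).-1.
    by rewrite /h' hornerD hornerN hornerZ hornerXn subrK.
  have [|||u2 [nu2 h2]] := IH (size h') _ h' erefl.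
  - apply: ltN => j Nj; rewrite coefB coefZ coefXn sh.
    case: eqP => [->|/eqP jN]; first by rewrite mulr1 lead_coefE sh subrr.
    rewrite mulr0 subr0; apply: nth_default; rewrite sh.
    by move: jN; rewrite -eqSS prednK // eq_sym => jN; rewrite -ltnS ltn_neqAle jN.
  - move=> i; rewrite coefB coefZ coefXn; apply: (SD) => //; apply: subringN => //.
    by apply: (SM); [exact: Sh|case: eqP].
  - by rewrite (_ : h'.[z] = h.[z] - lead_coef h * z ^+ (size h).-1);
      [apply: idealB => //; apply: ideal_mulr|rewrite eh addrK].
  exists (u1 * u2); split; first exact: primeMn.
  rewrite eh (_ : _ * _ = u1 * (u2 * h'.[z]) + u2 * z ^+ (size h).-1 * (u1 * lead_coef h));
    last by ring.
  by apply: (ID); apply: (IM) => //; apply: gsI.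
(* Now h competes with f in the minimality, and one step of pseudo-division by f lowers the degree;
   the factor lead_coef f is outside Q. *)
have sfh : (size f <= size h)%N by apply: minf; split=> //.
pose h' := lead_coef f *: h - lead_coef h *: ('X^(size h - size f) * f).
have eh : lead_coef f * h.[z] = h'.[z] + lead_coef h * z ^+ (size h - size f) * f.[z].
  by rewrite /h' hornerD hornerN !hornerZ hornerM hornerXn mulrA subrK.
have [|||u2 [nu2 h2]] := IH (size h') _ h' erefl.
- apply: ltN => j Nj; rewrite coefB !coefZ coefXnM.
  have f0 : (0 < size f)%N.
    by rewrite size_poly_gt0; apply: contra_not_neq nf => ->; rewrite lead_coef0.
  case: (eqVneq j N.-1) => [->|jN].
    have -> : (N.-1 < size h - size f)%N = false.
      by rewrite sh -subn1; apply/negbTE; rewrite -leqNgt leq_sub2l.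
    rewrite sh; have -> : (N.-1 - (N - size f) = (size f).-1)%N.
      by rewrite sh in sfh; rewrite -subn1 subnAC subKn // subn1.
    by rewrite [lead_coef h]lead_coefE sh [X in X * _ - _]lead_coefE mulrC subrr.
  have jN' : (N <= j)%N.
    by move: jN; rewrite -eqSS prednK // eq_sym => jN; rewrite -ltnS ltn_neqAle jN.
  rewrite nth_default ?sh // mulr0 sub0r.
  have -> : (j < N - size f)%N = false.
    by apply/negbTE; rewrite -leqNgt; apply: leq_trans jN'; apply: leq_subr.
  rewrite nth_default ?mulr0 ?oppr0 //.
  by rewrite -{1}(subKn sfh) sh; apply: leq_sub2r.
- move=> i; rewrite coefB !coefZ coefXnM; apply: (SD); first by apply: (SM) => //; apply: Sf.
  apply: subringN => //; apply: (SM); first exact: Sh.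
  by case: ifP.
- rewrite (_ : h'.[z] = lead_coef f * h.[z] - lead_coef h * z ^+ (size h - size f) * f.[z]).
    by apply: idealB => //; apply: (QM).
  by rewrite eh addrK.
exists (u2 * lead_coef f); split; first exact: primeMn.
rewrite -mulrA eh mulrDr; apply: (ID) => //; apply: (IM); apply: (IM).
by apply: ideal_gen_in; rewrite inE eqxx.
Qed.

Lemma ideal_gen_seq (gs : seq B) x : ideal_gen (fun g => g \in gs) x ->
  exists r : nat -> B, x = \sum_(i < size gs) r i * gs`_i.
Proof.
elim=> {x} [|a g hg|x z _ [r ->] _ [q ->]].
- by exists (fun _ => 0); rewrite big1 // => i _; rewrite mul0r.
- exists (fun i => if i == index g gs then a else 0).
  have ig : (index g gs < size gs)%N by rewrite index_mem.
  rewrite (bigD1 (Ordinal ig)) //= eqxx nth_index // big1 ?addr0 //.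
  by move=> i /negPf; rewrite -val_eqE /= => ->; rewrite mul0r.
- exists (fun i => r i + q i); rewrite -big_split; apply: eq_bigr => i _.
  by rewrite mulrDl.
Qed.

End Adjunction.

(** * Specializing the coefficients to elements of k *)

Section Specialized.
Variables (k : fieldType) (n : nat) (B : comAlgType k) (y : 'I_n -> B) (d s' : nat).
Let s := s'.+1.
Let e := (d + s)%N.
Let Bc := {mpoly B[(e * n)%N]}.

Definition form (c : 'M[k]_(e, n)) (i : 'I_e) : B := \sum_(j < n) c i j *: y j.

Definition ev (c : 'M[k]_(e, n)) : Bc -> B := meval (fun t => (mxvec c 0 t)%:A).
HB.instance Definition _ c := GRing.RMorphism.on (ev c).

Lemma ev_const c b : ev c b%:MP = b.
Proof. exact: mevalC. Qed.

Lemma ev_genA c w : genA y w -> subalg_gen (form c) (ev c w).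
Proof.
pose P w := subalg_gen (form c) (ev c w).
have PD w1 w2 : P w1 -> P w2 -> P (w1 + w2) by rewrite /P rmorphD; apply: sg_add.
have PM w1 w2 : P w1 -> P w2 -> P (w1 * w2) by rewrite /P rmorphM; apply: sg_mul.
have PC a : P (a%:A%:MP) by rewrite /P ev_const; apply: sg_scal.
have PX i j : P 'X_(mxvec_index i j) by rewrite /P /ev mevalXU mxvecE; apply: sg_scal.
have PZ i : P (\sum_j 'X_(mxvec_index i j) * (y j)%:MP).
  rewrite /P rmorph_sum; suff <- : form c i =
    \sum_j ev c ('X_(mxvec_index i j) * (y j)%:MP) by apply: sg_gen.
  apply: eq_bigr => j _.
  by rewrite rmorphM /= ev_const /ev mevalXU mxvecE mulr_algl.
suff PG G : P (gphi y idfun (@id 'I_e) G) by move=> [G ->]; apply: PG.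
clearbody P; elim/mpoly_closed_ind: G => [a|v|F G hF hG|F G hF hG].
- by rewrite gphiC; apply: PC.
- elim/var_ind: v => [i j|i]; first by rewrite gphi_c; apply: PX.
  by rewrite gphi_z; apply: PZ.
- by rewrite rmorphD; apply: PD.
- by rewrite rmorphM; apply: PM.
Qed.

Lemma ev_coefs_in c Q w : ideal_pred Q -> coefs_in Q w -> Q (ev c w).
Proof.
move=> hQ hw; rewrite /ev mevalE; apply: ideal_sum => // m _.
by apply: ideal_mulr => //; apply: hw.
Qed.

Lemma generic_notin Q w : ideal_pred Q -> ~ coefs_in Q w ->
  generic (fun c : 'M[k]_(e, n) => ~ Q (ev c w)).
Proof.
move=> hQ nw; have [f [f0 hf]] := specialize_notin hQ nw.
by exists f; split=> // c /hf.
Qed.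

(** Independence of the first d forms modulo Q makes the contraction to k[x] zero, generated by
    nothing. Each of the s other forms adds one generator. *)
Lemma generated_by_forms (c : 'M[k]_(e, n)) (Q : B -> Prop) : prime Q ->
  (forall F, Q (evalB (fun i : 'I_d => form c (lshift s i)) F) -> F = 0) ->
  (forall b, integral_mod (img (fun i : 'I_d => form c (lshift s i))) Q b) ->
  exists gs, size gs = s /\ generated_at Q (subalg_gen (form c)) gs.
Proof.
move=> pQ indep hint; set x := fun i : 'I_d => form c (lshift s i).
have steps r : (r <= s)%N -> exists S gs, [/\ subring_pred S, size gs = r,
    generated_at Q S gs, forall b, img x b -> S b
    & forall j : 'I_s, (j < r)%N -> S (form c (rshift d j))].
  elim: r => [|r IH] rs.
    exists (img x), [::]; split=> //; first exact: img_subring.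
    split=> // b [F ->] /indep ->; exists 1; split; first exact: prime_proper.
    by rewrite mul1r /evalB rmorph0; apply: ig_0.
  have [S [gs [hS sgs ggs x_in z_in]]] := IH (ltnW rs).
  pose z := form c (rshift d (Ordinal rs)).
  have hz : integral_mod S Q z.
    by have [m [a [ha Qa]]] := hint z; exists m, a; split=> // i; apply: x_in.
  have [g hg] := generated_adjoin pQ hS ggs hz.
  exists (adjoin S z), (g :: gs); split=> //=; first exact: adjoin_subring.
  - by rewrite sgs.
  - by move=> b /x_in; apply: adjoin_sub.
  - move=> j; rewrite ltnS leq_eqVlt => /orP [/eqP jr|jr].
      have -> : j = Ordinal rs by apply: val_inj.
      exact: adjoin_in.
    by apply: adjoin_sub => //; apply: z_in.
have [S [gs [hS sgs ggs x_in z_in]]] := steps s (leqnn s).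
exists gs; split=> //; case: ggs => Qgs hgs; split=> // b Ab; apply: hgs.
have [S1 _ SD SM] := hS.
elim: Ab => {b} [i|a|a b _ ha _ hb|a b _ ha _ hb]; [|apply: x_in|exact: SD|exact: SM].
  rewrite -(splitK i); case: (split i) => j /=; last exact: z_in.
  by apply: x_in; exists 'X_j; rewrite evalBX.
by exists a%:MP; rewrite evalBC.
Qed.

End Specialized.

Theorem theorem2p3 (k : fieldType) (n d s : nat) (B : comAlgType k)
    (y : 'I_n -> B) :
  infinite_field k -> perfect_field k ->
  generates y ->
  dim_eq (fun _ : B => True) (fun b : B => b = 0) d ->
  (0 < s)%N ->
  exists f : {mpoly k[((d + s) * n)%N]}, f != 0 /\
    forall c : 'M[k]_(d + s, n),
      f.@[fun t => mxvec c 0 t] != 0 ->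
      let A := subalg_gen (fun i : 'I_(d + s) => \sum_(j < n) c i j *: y j) in
      finite_over A /\
      (quot_dim_lt A d <->
        forall q : B -> Prop,
          prime_in (fun _ => True) q -> dim_eq (fun _ => True) q d ->
          edim_loc_le q s).
Proof.
move=> kinf kperf geny [dimd dimB]; case: s => // s' _.
have [x [N [linx hx]]] := noether kinf geny dimB.
have [F [F0 relF]] := generic_relation linx hx.
have [K [Q [tQ allQ]]] := finitely_many_top kinf geny dimB.
have pQ i : prime (Q i) by case: (tQ i).
have iQ i := prime_ideal (pQ i).
have /fin_all_exists [dt hdt] : forall i, exists dt : {mpoly B[((d + s'.+1) * n)%N]} *
     {mpoly B[((d + s'.+1) * n)%N]} * ('I_n -> {mpoly B[((d + s'.+1) * n)%N]}),
  [/\ genA y dt.1.1 /\ genA y dt.1.2,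
      coefs_in (Q i) dt.1.1 /\ ~ coefs_in (Q i) dt.1.2,
      forall b : B, exists N a (r : 'I_n -> {mpoly B[((d + s'.+1) * n)%N]}),
        genA y a /\ dt.1.2 ^+ N * b%:MP = a + \sum_j r j * dt.2 j,
      forall Q2, ideal_pred Q2 -> coefs_in Q2 dt.1.1 -> forall j, coefs_in Q2 (dt.2 j)
    & edim_loc_le (Q i) s'.+1 -> forall b, Q i b ->
        exists w : {mpoly B[((d + s'.+1) * n)%N]}, ~ coefs_in (Q i) w /\
          ideal_gen (gen_sq (d := d) (s' := s') y (Q i)) (w * b%:MP)].
  move=> i; have [eta0 [D0 [om h]]] := generic_local s' kperf geny F0 relF (pQ i).
  by exists (eta0, D0, om).
suff : generic (fun c : 'M[k]_(d + s'.+1, n) => finite_over (subalg_gen (form y c)) /\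
    (quot_dim_lt (subalg_gen (form y c)) d <->
      forall q : B -> Prop, prime_in (fun _ => True) q -> dim_eq (fun _ => True) q d ->
          edim_loc_le q s'.+1)) by [].
have g1 := normal_open s'.+1 linx hx.
have g2 : generic (fun c : 'M[k]_(d + s'.+1, n) => forall i, ~ Q i (ev c (dt i).1.2)).
  by apply: generic_all => i; apply: generic_notin => //; case: (hdt i) => _ [].
(* For each pair of primes: if eta0 of the first is in Q_i'[c], so are its omega_j and every
   specialization keeps them in Q_i'; if not, eta0 avoids Q_i' generically. *)
have g3 : generic (fun c : 'M[k]_(d + s'.+1, n) => forall i i',
    ~ Q i' (ev c (dt i).1.1) \/ forall j, Q i' (ev c ((dt i).2 j))).
  apply: generic_all => i; apply: generic_all => i'.
  have [h|h] := classic (coefs_in (Q i') (dt i).1.1).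
    apply: generic_true => c; right=> j; apply: ev_coefs_in => //.
    by case: (hdt i) => _ _ _ om _; apply: om.
  by apply: (generic_imp _ (generic_notin (iQ i') h)) => c nc; left.
(* The embedding dimension hypothesis does not involve c, so it is decided before the open set is
   chosen, and primes violating it impose no condition. *)
have g4 : generic (fun c : 'M[k]_(d + s'.+1, n) => forall i, edim_loc_le (Q i) s'.+1 ->
   exists b : 'I_s'.+1 -> B,
     (forall x, Q i x -> exists u, ~ Q i u /\
         exists r : 'I_s'.+1 -> B, u * x = \sum_t r t * b t) /\
     (forall t, exists w, ~ Q i w /\ ideal_gen (fun x =>
        (Q i x /\ subalg_gen (form y c) x) \/
        exists q1 q2, [/\ Q i q1, Q i q2 & x = q1 * q2]) (w * b t))).
  apply: generic_all => i.
  have [he|he] := classic (edim_loc_le (Q i) s'.+1); last by apply: generic_true => c /he.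
  have [b [Qb genb]] := edim_loc_family (pQ i) he.
  have [_ _ _ _ /(_ he) hw] := hdt i.
  have /fin_all_exists [w hwb] := fun t => hw _ (Qb t).
  apply: (@generic_imp _ _ _ (fun c => forall t, ~ Q i (ev c (w t)))); last first.
    by apply: generic_all => t; apply: generic_notin => //; case: (hwb t).
  move=> c nc _; exists b; split=> // t; exists (ev c (w t)); split=> //.
  have [_] := hwb t; rewrite -[b t in X in _ -> X](ev_const c) -rmorphM.
  have hI := ideal_gen_ideal (fun x =>
        (Q i x /\ subalg_gen (form y c) x) \/
        exists q1 q2, [/\ Q i q1, Q i q2 & x = q1 * q2]).
  elim=> [|a x0 hx0|x1 x2 _ h1 _ h2].
  - by rewrite rmorph0; case: hI.
  - rewrite rmorphM; apply: ig_in; case: hx0 => [[Qx Ax]|[q1 [q2 [Q1 Q2 ->]]]].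
      by left; split; [apply: ev_coefs_in|apply: ev_genA].
    right; exists (ev c q1), (ev c q2).
    by split; [apply: ev_coefs_in|apply: ev_coefs_in|rewrite rmorphM].
  - by rewrite rmorphD; case: hI => _ ID _; apply: ID.
apply: (generic_imp _ (generic_and (generic_and g1 g2) (generic_and g3 g4))).
move=> c [[h1 h2] [h3 h4]] {g1 g2 g3 g4}.
set A := subalg_gen (form y c).
pose z := fun i : 'I_d => form y c (lshift s'.+1 i).
have hA : subring_pred A by exact: subalg_gen_subring.
have zA b : img z b -> A b.
  move/subalg_genE; elim=> {b} [i|a|a b _ ha _ hb|a b _ ha _ hb].
  - exact: sg_gen.
  - exact: sg_scal.
  - exact: sg_add.
  - exact: sg_mul.
have linz i : lin y (z i) by exists (c (lshift s'.+1 i)).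
have i0 := ideal_only_zero B.
have intz := normal_integral geny i0 h1.
have intA b : integral_mod A only_zero b.
  by have [m [a [ha e0]]] := intz b; exists m, a; split=> // i; apply: zA; apply: ha.
have [q [u spanz]] := normal_span geny i0 h1.
have spanA b : exists a : 'I_q -> B, (forall i, A (a i)) /\ b = \sum_i a i * u i.
  have [G /eqP] := spanz b; rewrite subr_eq0 => /eqP ->.
  by exists (fun i => evalB z (G i)); split=> // i; apply: zA; exists (G i).
split.
  exists (codom u) => b; have [a [ha ->]] := spanA b.
  (* Coefficients are indexed by all naturals, so they default to 0 beyond the spanning family. *)
  exists (fun i => if insub i is Some j then a j else 0); split.
    by move=> i; case: insubP => [j _ _|_] //; apply: subring0.
  rewrite size_codom card_ord; apply: eq_bigr => i _.
  by rewrite valK (nth_map i) ?size_enum_ord // nth_ord_enum.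
split=> [hlt q0 pq [dq _]|hall].
  have tq : top d q0 by [].
  (* An element a outside q with aB in A moves q into the contraction of q, which the s forms
     control; locally a is invertible. *)
  have [a [[Aa hAa] na]] := conductor_of_dim hA intA hlt tq.
  have [|b|gs [sgs [Qgs hgs]]] := generated_by_forms (s' := s') (c := c) (y := y) pq.
  - move=> G hG; apply: (normal_indep kinf geny linz h1 _ pq dq hG).
    by move=> b ->; case: (prime_ideal pq).
  - by apply: integral_mod_sub (intz b) => _ ->; case: (prime_ideal pq).
  exists gs; split; first by rewrite sgs.
  split=> // b qb; have [|v [nv hv]] := hgs (a * b) (hAa b).
    by case: (prime_ideal pq) => _ _; apply.
  exists (v * a); split; first exact: primeMn.
  by rewrite -mulrA; apply: ideal_gen_seq.
apply: (conductor_dim hA intA) => Q' tQ'.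
have [i QQ'] := allQ Q' tQ'.
have [|b [genb sqb]] := h4 i.
  (* The upper bound on the dimension of B/Q_i is inherited from B. *)
  have [_ dQ] := tQ i; apply: hall; [exact: pQ|split=> // -[P [hP sP]]].
  apply: dimB; exists P; split=> // j hj; have [pP _] := hP j hj; split=> // _ ->.
  by case: (prime_ideal pP).
have [[A1 A2] [Q1 _] ex om _] := hdt i.
have [|||||||r [Ar nr hr]] := @conductor_notin k B d A hA intA dimB (Q i) (tQ i) n
  (ev c (dt i).1.2) (ev c (dt i).1.1) (fun j => ev c ((dt i).2 j)) _ _ _ _ _ _ _ _
  b genb sqb q u spanA.
- exact: ev_genA.
- exact: h2.
- exact: ev_genA.
- exact: ev_coefs_in.
- by move=> j; apply: ev_coefs_in => //; apply: om.
- move=> b0; have [N0 [a [r [Aa er]]]] := ex b0.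
  exists N0, (ev c a), (fun j => ev c (r j)); split; first exact: ev_genA.
  rewrite -[b0](ev_const c) -rmorphXn -rmorphM er rmorphD rmorph_sum; congr (_ + _).
  by apply: eq_bigr => j _; rewrite rmorphM.
- move=> Q2 tQ2; have [i' Q2E] := allQ Q2 tQ2.
  by case: (h3 i i') => h; [left=> /Q2E|right=> j; apply/Q2E].
- by exists r; split=> // /QQ'.
Qed.
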